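(* Let $d,k\ge 1$, let $\mu=(\mu_1,\dots,\mu_k)$ be a vector of Borel probability measures on $\mathbb{R}^d$, let $\nu$ be a Borel probability measure on $\mathbb{R}^d$ which is quasi-Ahlfors regular with some index $\alpha>0$, let $\theta$ be a Borel probability measure on $\mathbb{R}^d$, and let $q=(q_1,\dots,q_k)\in\mathbb{R}^k$ and $t\in\mathbb{R}$. Then there exist constants $C_1,C_2>0$ such that for every Borel set $E\subseteq S_\mu$: $$C_1\,\mathcal{H}_{\mu,\nu}^{q,t}(E)\,\inf_{x\in E}\overline{d}_{\mu,\nu}^{q,t}(x,\theta)\;\le\;\theta(E)\;\le\; C_2\,\mathcal{H}_{\mu,\nu}^{q,t}(E)\,\sup_{x\in E}\overline{d}_{\mu,\nu}^{q,t}(x,\theta)$$ whenever $\mathcal{H}_{\mu,\nu}^{q,t}(E)<\infty$, and $$C_1\,\mathcal{P}_{\mu,\nu}^{q,t}(E)\,\inf_{x\in E}\underline{d}_{\mu,\nu}^{q,t}(x,\theta)\;\le\;\theta(E)\;\le\; C_2\,\mathcal{P}_{\mu,\nu}^{q,t}(E)\,\sup_{x\in E}\underline{d}_{\mu,\nu}^{q,t}(x,\theta)$$ whenever $\mathcal{P}_{\mu,\nu}^{q,t}(E)<\infty$.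
   Context: Notation. $B(x,r)$ is the closed ball of centre $x$ and radius $r$ in $\mathbb{R}^d$; $|U|$ is the diameter of $U$. For the vector $\mu$, $S_\mu=\bigcap_{i=1}^k S_{\mu_i}$, where $S_{\mu_i}$ is the topological support of $\mu_i$. For $q\in\mathbb{R}^k$ write $\mu(B(x,r))^q=\prod_{i=1}^k \mu_i(B(x,r))^{q_i}$. Quasi-Ahlfors regularity. A Borel probability measure $\nu$ on $\mathbb{R}^d$ is quasi-Ahlfors regular with index $\alpha>0$ if $\limsup_{|U|\to 0}\nu(U)/|U|^{\alpha}<+\infty$. Coverings and packings. A centred $\delta$-covering of $E$ is a countable family of balls $(B(x_i,r_i))_i$ with $x_i\in E$, $0<r_i\le\delta$, and $E\subseteq\bigcup_i B(x_i,r_i)$. A centred $\delta$-packing of $E$ is a countable family of pairwise disjoint balls $(B(x_i,r_i))_i$ with $x_i\in E$, $0<r_i\le\delta$. Mixed multifractal Hausdorff measure: for $E\subseteq\mathbb{R}^d$, $$\overline{\mathcal{H}}_{\mu,\nu,\delta}^{q,t}(E)=\inf\Big\{\sum_i \mu(B(x_i,r_i))^q\,\nu(B(x_i,r_i))^t\Big\},$$ the infimum being over all centred $\delta$-coverings of $E$; $$\overline{\mathcal{H}}_{\mu,\nu}^{q,t}(E)=\lim_{\delta\downarrow0}\overline{\mathcal{H}}_{\mu,\nu,\delta}^{q,t}(E)=\sup_{\delta>0}\overline{\mathcal{H}}_{\mu,\nu,\delta}^{q,t}(E),\qquad \mathcal{H}_{\mu,\nu}^{q,t}(E)=\sup_{F\subseteq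 E}\overline{\mathcal{H}}_{\mu,\nu}^{q,t}(F).$$ Mixed multifractal packing measure: for $E\subseteq\mathbb{R}^d$, $$\overline{\mathcal{P}}_{\mu,\nu,\delta}^{q,t}(E)=\sup\Big\{\sum_i \mu(B(x_i,r_i))^q\,\nu(B(x_i,r_i))^t\Big\},$$ the supremum being over all centred $\delta$-packings of $E$; $$\overline{\mathcal{P}}_{\mu,\nu}^{q,t}(E)=\lim_{\delta\downarrow0}\overline{\mathcal{P}}_{\mu,\nu,\delta}^{q,t}(E)=\inf_{\delta>0}\overline{\mathcal{P}}_{\mu,\nu,\delta}^{q,t}(E),\qquad \mathcal{P}_{\mu,\nu}^{q,t}(E)=\inf_{E\subseteq\bigcup_i E_i}\sum_i\overline{\mathcal{P}}_{\mu,\nu}^{q,t}(E_i),$$ the last infimum being over countable covers $(E_i)$ of $E$. Densities. The upper and lower $(q,t)$-densities of $\theta$ at $x$ relative to $(\mu,\nu)$ are $$\overline{d}_{\mu,\nu}^{q,t}(x,\theta)=\limsup_{r\to0}\frac{\theta(B(x,r))}{\mu(B(x,r))^q\,\nu(B(x,r))^t},\qquad \underline{d}_{\mu,\nu}^{q,t}(x,\theta)=\liminf_{r\to0}\frac{\theta(B(x,r))}{\mu(B(x,r))^q\,\nu(B(x,r))^t}.$$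
   Formalization: Each upper bound for θ(E) is asserted except when its right-hand side is 0·∞ (the measure of E is 0 and the supremum of the densities is +∞); with 0·∞ = 0 it fails there, e.g. θ a Dirac mass at x, E = {x}, ν uniform on a cube, q = 0, t = 1. Lower bounds use 0·∞ = 0. *)

(* Defs.v *)
From HB Require Import structures.
From mathcomp Require Import all_boot all_order all_algebra.
From mathcomp Require Import all_classical all_reals all_analysis.
Import Order.TTheory GRing.Theory Num.Theory.
Import numFieldNormedType.Exports.

Set Implicit Arguments.
Unset Strict Implicit.
Unset Printing Implicit Defensive.

Local Open Scope classical_set_scope.
Local Open Scope ring_scope.
Local Open Scope ereal_scope.

(* R^d with its Borel sigma-algebra.  The library norm on 'rV[R]_d is the sup
   norm; it induces the usual topology, hence the usual Borel sets, but balls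
   and diameters are Euclidean and are defined below. *)
Notation Rd R d := (g_sigma_algebraType (@open 'rV[R]_d)).

Definition edist (R : realType) (d : nat) (x y : 'rV[R]_d) : R :=
  Num.sqrt (\sum_(i < d) (x ord0 i - y ord0 i) ^+ 2)%R.

Definition eball (R : realType) (d : nat) (x : 'rV[R]_d) (r : R)
    : set 'rV[R]_d :=
  [set y | (edist x y <= r)%R].

(* Equal to -oo on the empty set. *)
Definition diam (R : realType) (d : nat) (U : set 'rV[R]_d) : \bar R :=
  ereal_sup [set z | exists x y, [/\ U x, U y & z = (edist x y)%:E]].

Definition msupport (R : realType) (d : nat) (m : probability (Rd R d) R)
    : set 'rV[R]_d :=
  [set x | forall U : set 'rV[R]_d, open U -> U x -> 0 < m U].

Definition Smu (R : realType) (d k : nat) (mu : 'I_k -> probability (Rd R d) R)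
    : set 'rV[R]_d :=
  \bigcap_(i in [set: 'I_k]) msupport (mu i).

(* The limsup, as |U| -> 0, of nu(U) / |U|^alpha; U ranges over the Borel sets
   of positive diameter. *)
Definition quasi_ahlfors (R : realType) (d : nat) (nu : probability (Rd R d) R)
    (alpha : R) : Prop :=
  ereal_inf
    [set ereal_sup
       [set nu U / (diam U `^ alpha) | U in
          [set U : set (Rd R d) |
             [/\ measurable U, 0 < diam U & diam U <= delta%:E]]]
    | delta in [set delta : R | (0 < delta)%R]] < +oo.

(* x^s with the convention 0^s = +oo for s < 0 (whereas the library's poweR
   gives 0); as for poweR, 0^0 = 1 and 0^s = 0 for s > 0. *)
Definition epow (R : realType) (x : \bar R) (s : R) : \bar R :=
  if (x == 0) && (s < 0)%R then +oo else x `^ s.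

Section Multifractal.
Context (R : realType) (d k : nat).
Variables (mu : 'I_k -> probability (Rd R d) R) (nu : probability (Rd R d) R).
Variables (q : 'I_k -> R) (t : R).
Implicit Types (E : set 'rV[R]_d) (delta : R).

(* mu(B(x,r))^q nu(B(x,r))^t *)
Definition gauge (x : 'rV[R]_d) (r : R) : \bar R :=
  (\prod_(i < k) epow (mu i (eball x r)) (q i)) * epow (nu (eball x r)) t.

(* A countable family (possibly finite or empty) of balls is indexed by an
   arbitrary set I of natural numbers. *)
Definition centred_balls delta E (I : set nat) (x : nat -> 'rV[R]_d)
    (r : nat -> R) : Prop :=
  forall i, I i -> E (x i) /\ (0 < r i <= delta)%R.

Definition centred_covering delta E (I : set nat) (x : nat -> 'rV[R]_d)
    (r : nat -> R) : Prop :=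
  centred_balls delta E I x r /\ E `<=` \bigcup_(i in I) eball (x i) (r i).

Definition centred_packing delta E (I : set nat) (x : nat -> 'rV[R]_d)
    (r : nat -> R) : Prop :=
  centred_balls delta E I x r /\ trivIset I (fun i => eball (x i) (r i)).

Definition Hdelta delta E : \bar R :=
  ereal_inf [set s | exists I x r, centred_covering delta E I x r /\
                       s = \esum_(i in I) gauge (x i) (r i)].

Definition Hbar E : \bar R :=
  ereal_sup [set Hdelta delta E | delta in [set delta : R | (0 < delta)%R]].

Definition Hmeas E : \bar R :=
  ereal_sup [set Hbar F | F in [set F | F `<=` E]].

Definition Pdelta delta E : \bar R :=
  ereal_sup [set s | exists I x r, centred_packing delta E I x r /\
                       s = \esum_(i in I) gauge (x i) (r i)].

Definition Pbar E : \bar R :=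
  ereal_inf [set Pdelta delta E | delta in [set delta : R | (0 < delta)%R]].

Definition Pmeas E : \bar R :=
  ereal_inf [set \sum_(0 <= n <oo) Pbar (F n) | F in
               [set F : nat -> set 'rV[R]_d | E `<=` \bigcup_n F n]].

(* Division is that of \bar R: a / 0 = +oo for a > 0, 0 / 0 = 0 and
   a / +oo = 0 for finite a. *)
Definition density_ratio (theta : probability (Rd R d) R) (x : 'rV[R]_d)
    (r : R) : \bar R :=
  theta (eball x r) / gauge x r.

Definition udensity (theta : probability (Rd R d) R) (x : 'rV[R]_d) : \bar R :=
  limf_esup (density_ratio theta x) 0^'+.

Definition ldensity (theta : probability (Rd R d) R) (x : 'rV[R]_d) : \bar R :=
  limf_einf (density_ratio theta x) 0^'+.

End Multifractal.

(* Main.v *)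
Require Import Defs.
From HB Require Import structures.
From mathcomp Require Import all_boot all_order all_algebra.
From mathcomp Require Import all_classical all_reals all_analysis.
From mathcomp Require Import measurable_realfun.
From mathcomp Require Import ring lra zify.
Import Order.TTheory GRing.Theory Num.Theory.
Import numFieldNormedType.Exports.
(* so that [edist] below is the Euclidean distance, not that of a pseudometric space *)
Import Defs.

(** Write [g(x, r)] for the gauge [mu(B(x, r))^q nu(B(x, r))^t].  A bound on a
    density at every point of [E] compares [theta] with [s g] on small balls
    centred on [E], and each of the four inequalities sums such a comparison over a
    family of balls that covers [E] or is disjoint.

    - Upper bound by [H] ([theta_le_Hmeas]).  If the upper density is below [s] on
      [E], then [E] is the increasing union of the sets [E_n] of points at which
      [theta <= s g] for all radii up to [1/(n+1)].  Any centred covering of [E_n]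
      by such balls gives [theta(E_n) <= s H(E)].

    - Lower bound for [theta] in terms of [H] ([Hmeas_le]), upper bound by [P]
      ([theta_le_Pmeas]).  The comparison is now available for arbitrarily small,
      but only for some, radii, one ball per point.  Besicovitch's theorem
      ([besicovitch]) extracts a countable subfamily that still covers and whose
      finite parts split into [N] packings, [N] depending on [d] only.  For [H] the
      subfamily is a covering and the packings, kept inside an open set of almost
      the mass of [E] ([outer_regular]), bound its sum by [N theta(E)]; for [P] the
      subfamily carries the mass and the packings are bounded by the packing
      measure.

    - Lower bound for [theta] in terms of [P] ([Pmeas_le]).  The sets [E_n] where
      [s g <= theta] for all radii below [1/(n+1)] are Borel
      ([measurable_gauge_dominated]), so [E] may be replaced by the differences
      [E_(n+1) - E_n], and it is enough to treat a set on which the comparison is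
      uniform ([Pmeas_le_uniform]).  A packing centred in this set [A] has
      total mass at most that of a neighbourhood of [A], not of [A] itself.  To
      stay inside an open [U] containing [A], cut [A] into shells according to the
      distance to the complement of [U]; the neighbourhoods of the shells overlap at
      most three times, hence [s P(A) <= 3 theta(U)].

    The bounds with [s] in place of the infimum or the supremum of the densities
    give the theorem by letting [s] tend to it ([density_lower_bound],
    [density_upper_bound]). *)

Set Implicit Arguments.
Unset Strict Implicit.
Unset Printing Implicit Defensive.

Local Open Scope classical_set_scope.
Local Open Scope ring_scope.

(** * The Euclidean distance *)

Section Euclidean.
Context (R : realType) (d : nat).
Implicit Types (x y z : 'rV[R]_d).

Lemma edist_ge0 x y : 0 <= edist x y.
Proof. exact: sqrtr_ge0. Qed.

Lemma edistxx x : edist x x = 0.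
Proof. by rewrite /edist big1 ?sqrtr0// => i _; rewrite subrr expr0n. Qed.

Lemma edistC x y : edist x y = edist y x.
Proof.
by rewrite /edist; congr Num.sqrt; apply: eq_bigr => i _; rewrite -sqrrN opprB.
Qed.

Lemma le_coord_edist x y i : `|x ord0 i - y ord0 i| <= edist x y.
Proof.
rewrite -sqrtr_sqr ler_wsqrtr// (bigD1 i)//= lerDl.
by apply: sumr_ge0 => j _; exact: sqr_ge0.
Qed.

Lemma edist_le_sum x y : edist x y <= \sum_i `|x ord0 i - y ord0 i|.
Proof.
have S0 : 0 <= \sum_i `|x ord0 i - y ord0 i| by exact: sumr_ge0.
rewrite -[leRHS](ger0_norm S0) -sqrtr_sqr ler_wsqrtr// expr2 mulr_suml.
apply: ler_sum => i _; rewrite -real_normK ?num_real// expr2.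
by rewrite ler_wpM2l// (bigD1 i)//= lerDl sumr_ge0.
Qed.

Lemma CauchySchwarz_sum (a b : 'I_d -> R) :
  (\sum_i a i * b i) ^+ 2 <= (\sum_i a i ^+ 2) * (\sum_i b i ^+ 2).
Proof.
rewrite -subr_ge0.
suff -> : (\sum_i a i ^+ 2) * (\sum_i b i ^+ 2) - (\sum_i a i * b i) ^+ 2 =
    2^-1 * \sum_i \sum_j (a i * b j - a j * b i) ^+ 2.
  by rewrite mulr_ge0// sumr_ge0// => i _; apply: sumr_ge0 => j _; exact: sqr_ge0.
have E1 : \sum_i \sum_j (a i * b j - a j * b i) ^+ 2 =
   \sum_i \sum_j (a i ^+ 2 * b j ^+ 2) + \sum_i \sum_j (a j ^+ 2 * b i ^+ 2)
   - 2 * \sum_i \sum_j (a i * b i) * (a j * b j).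
  rewrite mulr_sumr -!big_split/= -sumrB; apply: eq_bigr => i _.
  rewrite mulr_sumr -!big_split/= -sumrB; apply: eq_bigr => j _; ring.
rewrite E1 [X in _ + X - _]exchange_big/= expr2 !big_distrlr/=.
by field.
Qed.

Lemma edist_triangle y x z : edist x z <= edist x y + edist y z.
Proof.
rewrite /edist; set a := fun i => x ord0 i - y ord0 i.
set b := fun i => y ord0 i - z ord0 i.
have A0 : 0 <= \sum_i a i ^+ 2 by apply: sumr_ge0 => i _; exact: sqr_ge0.
have B0 : 0 <= \sum_i b i ^+ 2 by apply: sumr_ge0 => i _; exact: sqr_ge0.
rewrite -[leRHS](ger0_norm (addr_ge0 (sqrtr_ge0 _) (sqrtr_ge0 _))) -sqrtr_sqr.
apply: ler_wsqrtr; rewrite sqrrD !sqr_sqrtr//.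
have -> : \sum_i (x ord0 i - z ord0 i) ^+ 2 =
   \sum_i a i ^+ 2 + (\sum_i a i * b i) *+ 2 + \sum_i b i ^+ 2.
  rewrite -mulr_natl mulr_sumr -!big_split/=; apply: eq_bigr => i _.
  by rewrite /a /b; ring.
rewrite lerD2r lerD2l lerMn2r/= (le_trans (ler_norm _))// -sqrtr_sqr -sqrtrM//.
by apply: ler_wsqrtr; exact: CauchySchwarz_sum.
Qed.

Lemma edist_scale (c : R) x y : edist (c *: x) (c *: y) = `|c| * edist x y.
Proof.
rewrite /edist -sqrtr_sqr -sqrtrM ?sqr_ge0// mulr_sumr; congr Num.sqrt.
by apply: eq_bigr => i _; rewrite !mxE -mulrBr exprMn.
Qed.

Lemma edist_sub x y z : edist (x - z) (y - z) = edist x y.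
Proof.
by rewrite /edist; congr Num.sqrt; apply: eq_bigr => i _; rewrite !mxE; congr (_ ^+ 2); ring.
Qed.

(** The library topology of R^d comes from the sup norm; this is the only point at
    which it is compared with the Euclidean distance. *)
Lemma open_edistP (U : set 'rV[R]_d) :
  open U <-> forall x, U x -> exists2 e, 0 < e & forall y, edist x y < e -> U y.
Proof.
rewrite openE; split=> [oU x /oU|oU x /oU [e e0 Ue]].
  move=> /nbhs_ballP[e /= e0 Ue]; exists e => // y xy; apply: Ue.
  split=> // i j; rewrite (ord1 i); apply: le_lt_trans xy.
  exact: le_coord_edist.
apply/nbhs_ballP; exists (e / d.+1%:R) => /=; first by rewrite divr_gt0.
move=> y xy; apply: Ue; apply: le_lt_trans (edist_le_sum x y) _.
apply: (@le_lt_trans _ _ (\sum_(i < d) e / d.+1%:R)).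
  by apply: ler_sum => i _; apply/ltW; exact: (xy.2 ord0 i).
rewrite sumr_const card_ord -[_ *+ d]mulr_natl mulrCA gtr_pMr//.
by rewrite ltr_pdivrMr// mul1r ltr_nat.
Qed.

End Euclidean.

(** * Besicovitch's covering theorem *)

(** Greedy colouring in order of increasing [g]: an element is coloured after all
    those it may conflict with, and these use at most [N] colours. *)
Lemma greedy_colouring (T : eqType) (P : T -> Prop) (g : T -> nat)
    (conf : T -> T -> Prop) (N : nat) :
  (forall x y, conf x y -> conf y x) ->
  (forall y t, P y -> uniq t ->
     (forall x, x \in t -> [/\ P x, (g x <= g y)%N & conf x y]) ->
     (size t <= N)%N) ->
  forall s, uniq s -> (forall x, x \in s -> P x) ->
  exists col : T -> 'I_N.+1, forall x y, x \in s -> y \in s -> x <> y ->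
    conf x y -> col x <> col y.
Proof.
move=> confC bnd s; have [n] := ubnP (size s); elim: n s => // n IH s sn us Ps.
have [->|s0] := eqVneq s [::]; first by exists (fun=> ord0).
have [y ys ymax] : exists2 y, y \in s & forall x, x \in s -> (g x <= g y)%N.
  case: s s0 {sn us Ps} => // a s _; elim: s => [|b s [y ys ymax]].
    by exists a => [|x]; rewrite inE// => /eqP ->.
  have [gyb|gyb] := leqP (g y) (g b).
    exists b => [|x]; first by rewrite !inE eqxx orbT.
    rewrite !inE => /or3P[/eqP->|/eqP->//|xs].
    - by rewrite (leq_trans _ gyb)// ymax// inE eqxx.
    - by rewrite (leq_trans _ gyb)// ymax// inE xs orbT.
  exists y => [|x]; first by move: ys; rewrite !inE => /orP[->//|->]; rewrite !orbT.
  rewrite !inE => /or3P[/eqP->|/eqP->|xs]; last by rewrite ymax// inE xs orbT.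
  - by rewrite ymax// inE eqxx.
  - exact: ltnW.
have [||x|col colP] := IH (rem y s).
- by rewrite size_rem//; case: (s) s0 sn.
- exact: rem_uniq.
- by move=> /mem_rem /Ps.
pose t := [seq x <- rem y s | `[< conf x y >]].
have tN : (size t <= N)%N.
  apply: (bnd y) => [||x]; first exact: Ps.
    by rewrite filter_uniq// rem_uniq.
  rewrite mem_filter => /andP[/asboolP xy /mem_rem xs].
  by split; [exact: Ps|exact: ymax|].
have [k kP] : exists k : 'I_N.+1, k \notin map col t.
  apply/existsP; rewrite -negb_forall; apply/negP => /forallP H.
  have : (#|{: 'I_N.+1}| <= size (map col t))%N.
    apply: leq_trans (card_size _); apply/subset_leq_card/fintype.subsetP => i _.
    exact: H.
  by rewrite card_ord size_map ltnNge tN.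
exists (fun x => if x == y then k else col x) => x z xs zs xz xzc.
have inr w : w \in s -> w != y -> w \in rem y s by rewrite mem_rem_uniq// inE => -> ->.
case: eqVneq => [xy|xy]; case: eqVneq => [zy|zy].
- by rewrite xy zy in xz.
- move=> kz; move: kP; rewrite kz map_f// mem_filter inr// andbT.
  by apply/asboolP; apply: confC; rewrite -xy.
- move=> kz; move: kP; rewrite -kz map_f// mem_filter inr// andbT.
  by apply/asboolP; rewrite -zy.
- by apply: colP => //; exact: inr.
Qed.

Section Besicovitch.
Context (R : realType) (d : nat).
Implicit Types (x y z : 'rV[R]_d).
Local Notation D := (d.+1%:R : R).

(** With mesh [h / d.+1], any two points of a cell are at distance less than [h]. *)
Definition grid_cell (h : R) (x : 'rV[R]_d) : {ffun 'I_d -> int} :=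
  [ffun i => Num.floor (x ord0 i * D / h)].

Lemma floor_eq_lt1 (a b : R) : Num.floor a = Num.floor b -> `|a - b| < 1.
Proof.
move=> ab; have := floorD1_gt a; have := floor_le a.
have := floorD1_gt b; have := floor_le b; rewrite ab intrD.
by move=> *; rewrite ltr_norml; apply/andP; split; lra.
Qed.

Lemma grid_cell_lt h x y : 0 < h -> grid_cell h x = grid_cell h y ->
  edist x y < h.
Proof.
move=> h0 /ffunP xy; apply: le_lt_trans (edist_le_sum x y) _.
apply: (@le_lt_trans _ _ (\sum_(i < d) h / D)).
  apply: ler_sum => i _; have := xy i; rewrite !ffunE => /floor_eq_lt1.
  rewrite -mulrBl -mulrBl normrM normrM (ger0_norm (ltW (_ : 0 < h^-1))) ?invr_gt0//.
  rewrite (ger0_norm (_ : 0 <= D))// ltr_pdivrMr// mul1r => H.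
  by rewrite ler_pdivlMr// ltW.
rewrite sumr_const card_ord -[_ *+ d]mulr_natl mulrCA gtr_pMr//.
by rewrite ltr_pdivrMr// mul1r ltr_nat.
Qed.

Lemma edist_scale2 (c c' : R) x :
  edist (c *: x) (c' *: x) = `|c - c'| * edist x 0.
Proof.
rewrite -edist_scale scaler0 -[in RHS](edist_sub _ _ (- (c' *: x))).
by rewrite scalerBl !opprK subrK add0r.
Qed.

(** Two balls that are large compared with a ball [B(y, rho)] which they both
    touch, none of the centres lying in an earlier one of the balls, are seen from
    [y] in directions at distance more than 1/2. *)
Lemma direction_separated (rho ra rb : R) (a b y : 'rV[R]_d) :
  0 < rho -> 4 * rho <= ra -> 4 * rho <= rb -> rb <= ra ->
  ra < edist a y -> edist a y <= ra + rho ->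
  rb < edist b y -> edist b y <= rb + rho -> ra < edist a b ->
  2^-1 < edist ((edist a y)^-1 *: (a - y)) ((edist b y)^-1 *: (b - y)).
Proof.
move=> rho0 rara rarb rba aA Aa bB Bb ab.
set A := edist a y in aA Aa *; set B := edist b y in bB Bb *.
set u := _ *: _; set v := _ *: _.
have A0 : 0 < A by lra.
have B0 : 0 < B by lra.
have ua : a - y = A *: u by rewrite scalerA divff ?scale1r// gt_eqF.
have vb : b - y = B *: v by rewrite scalerA divff ?scale1r// gt_eqF.
have n1 x : 0 < edist x y -> edist ((edist x y)^-1 *: (x - y)) 0 = 1.
  move=> x0; rewrite -[X in edist _ X](scaler0 _ (edist x y)^-1) edist_scale.
  rewrite -(subrr y) edist_sub gtr0_norm ?invr_gt0// mulVf// gt_eqF//.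
have u1 : edist u 0 = 1 by exact: n1.
have v1 : edist v 0 = 1 by exact: n1.
have e0 := edist_ge0 u v.
rewrite ltNge; apply/negP => e2.
have abE : edist a b = edist (A *: u) (B *: v) by rewrite -ua -vb edist_sub.
have [BA|AB] := leP B A.
  have := edist_triangle (B *: u) (A *: u) (B *: v).
  rewrite edist_scale2 edist_scale u1 mulr1 -abE (ger0_norm (ltW B0)) ger0_norm ?subr_ge0//.
  move=> H; have : B * edist u v <= B * 2^-1 by rewrite ler_wpM2l// ltW.
  lra.
have AB0 : 0 <= B - A by rewrite subr_ge0 ltW.
have := edist_triangle (A *: v) (A *: u) (B *: v).
rewrite edist_scale2 edist_scale v1 mulr1 -abE distrC (ger0_norm (ltW A0)) (ger0_norm AB0).
move=> H; have : A * edist u v <= A * 2^-1 by rewrite ler_wpM2l// ltW.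
lra.
Qed.

(** Codes the integers of absolute value at most [n]; this and [grid_cell] turn the
    volume and angle arguments of the usual proof into pigeonholes. *)
Definition int_code (n : nat) (z : int) : 'I_(2 * n).+1 := inord (absz (z + n%:Z)).

Lemma int_code_inj n (z z' : int) : `|z| <= n%:Z -> `|z'| <= n%:Z ->
  int_code n z = int_code n z' -> z = z'.
Proof.
by move=> zn zn' /(congr1 val); rewrite /= !inordK; lia.
Qed.

Lemma floor_norm_le (a : R) (n : nat) : `|a| <= n%:R -> `|Num.floor a| <= n%:Z.
Proof.
rewrite !ler_norml => /andP[na an]; apply/andP; split.
  by rewrite floor_ge_int intrN.
by rewrite -(ler_int R) (le_trans (floor_le a)).
Qed.

Lemma floor_dist_le (a b : R) (n : nat) : `|a - b| <= n%:R ->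
  `|Num.floor a - Num.floor b| <= n.+1%:Z.
Proof.
rewrite ler_norml => /andP[h1 h2].
have := floorD1_gt a; have := floor_le a.
have := floorD1_gt b; have := floor_le b; rewrite !intrD => *.
rewrite -(ler_int R) intr_norm intrB ler_norml -[n.+1]addn1 PoszD intrD.
by apply/andP; split; rewrite pmulrn in h1 h2 *; lra.
Qed.

(** The selection of the centres.  The radii are sorted into dyadic generations.
    One generation after the other, among the points not covered by the balls
    already kept, one point is kept per occupied cell of a grid whose mesh is
    proportional to the radii of the generation: the ball around it covers its cell.
    A kept point lies in no ball of an earlier generation. *)
Section Selection.
Variables (F : set 'rV[R]_d) (r : 'rV[R]_d -> R) (M : R).
Hypothesis r_bnd : forall x, F x -> 0 < r x <= M.

Definition gen_radius (g : nat) : R := M / 2 ^+ g.+1.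
Local Notation rho := gen_radius.

Definition gen x : nat :=
  xget 0%N [set g | rho g < r x <= 2 * rho g].

Lemma gen_radiusS g : rho g = 2 * rho g.+1.
Proof. by rewrite /rho [2 ^+ g.+2]exprS; field; rewrite expf_neq0. Qed.

Lemma gen_radius_gt0 x g : F x -> 0 < rho g.
Proof.
move=> /r_bnd /andP[r0 rM]; rewrite divr_gt0// ?exprn_gt0//.
exact: lt_le_trans rM.
Qed.

Lemma gen_radius_le g h : 0 <= M -> (g <= h)%N -> rho h <= rho g.
Proof.
move=> M0 gh; rewrite ler_wpM2l// lef_pV2 ?posrE ?exprn_gt0//.
by rewrite ler_eXn2l// ltr1n.
Qed.

Lemma max_radius_ge0 x : F x -> 0 <= M.
Proof. by move=> /r_bnd /andP[r0 /(lt_le_trans r0)/ltW]. Qed.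

Lemma genP x : F x -> rho (gen x) < r x <= 2 * rho (gen x).
Proof.
move=> Fx; rewrite /gen; case: xgetP => //= noG; exfalso.
have /andP[r0 rM] := r_bnd Fx.
have H g : r x <= 2 * rho g.
  elim: g => [|g IH]; first by rewrite /rho expr1 mulrCA divff// mulr1.
  rewrite leNgt; apply/negP => Hg; apply: (noG g).
  by rewrite IH andbT gen_radiusS.
have M0 : 0 < M := lt_le_trans r0 rM.
pose n := (Num.truncn (M / r x)).+1.
have nM : M / r x < n%:R by exact: truncnS_gt.
have := H n; apply/negP; rewrite -ltNge /rho exprS invfM mulrCA.
rewrite [2 * _]mulrA divff// mul1r ltr_pdivrMr ?exprn_gt0//.
move: nM; rewrite ltr_pdivrMr// => /lt_le_trans -> //.
by rewrite mulrC ler_wpM2l ?(ltW r0)// -natrX ler_nat ltnW// ltn_expl.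
Qed.

Lemma gen_lt_radius x y : F x -> F y -> (gen x < gen y)%N -> r y < r x.
Proof.
move=> Fx Fy xy; have /andP[h1 _] := genP Fx; have /andP[_ h2] := genP Fy.
apply: le_lt_trans h1; apply: le_trans h2 _; rewrite -(ltn_predK xy) -gen_radiusS.
by apply: gen_radius_le (max_radius_ge0 Fx) _; lia.
Qed.

Definition generation_reps (g : nat) (C : set 'rV[R]_d) : set 'rV[R]_d :=
  [set x | [/\ F x, gen x = g, ~ C x &
     x = xget 0 [set z | [/\ F z, gen z = g, ~ C z &
                   grid_cell (rho g) z = grid_cell (rho g) x]]]].

Fixpoint covered (g : nat) : set 'rV[R]_d :=
  if g is h.+1 then
    covered h `|` \bigcup_(x in generation_reps h (covered h)) eball x (r x)
  else set0.

Definition selected : set 'rV[R]_d :=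
  [set x | generation_reps (gen x) (covered (gen x)) x].

Lemma selectedF x : selected x -> F x. Proof. by case. Qed.

Lemma covered_selected g x : covered g x ->
  exists2 z, selected z & eball z (r z) x.
Proof.
elim: g => //= g IH [/IH//|[z rz zx]]; exists z => //.
by case: (rz) => _ gz _ _; rewrite /selected/= gz.
Qed.

Lemma covered_le g h : (g <= h)%N -> covered g `<=` covered h.
Proof.
move=> /subnKC <-; elim: (h - g)%N => [|n IH]; first by rewrite addn0.
by rewrite addnS => x /IH; left.
Qed.

Lemma selected_cover : F `<=` \bigcup_(z in selected) eball z (r z).
Proof.
move=> x Fx; have [/covered_selected//|nC] := pselect (covered (gen x) x).
set g := gen x in nC *.
pose cand c := [set z | [/\ F z, gen z = g, ~ covered g z &
                   grid_cell (rho g) z = c]].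
pose z := xget 0 (cand (grid_cell (rho g) x)).
have [Fz gz nCz czx] : cand (grid_cell (rho g) x) z by exact: (@xgetI _ 0 _ x).
exists z; first by rewrite /selected/= gz; split => //; rewrite /z -[in LHS]czx.
rewrite /eball/=; apply/ltW.
have /andP[+ _] := genP Fz; rewrite gz; apply: lt_trans.
by apply: grid_cell_lt => //; exact: gen_radius_gt0 Fx.
Qed.

Lemma selected_gen_lt x y : selected x -> selected y -> (gen x < gen y)%N ->
  r x < edist x y.
Proof.
move=> Sx [_ _ nC _] xy; rewrite ltNge; apply/negP => xyr; apply: nC.
by apply: (covered_le xy); right; exists x.
Qed.

Lemma selected_cell_inj x y : selected x -> selected y -> gen x = gen y ->
  grid_cell (rho (gen x)) x = grid_cell (rho (gen x)) y -> x = y.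
Proof.
move=> [_ _ _ Ex] [_ _ _ Ey] xy cxy; rewrite Ex Ey -xy.
by rewrite -cxy.
Qed.

(** A selected point is determined by its generation and its cell. *)
Lemma selected_countable : exists idx : 'rV[R]_d -> nat,
  forall x y, selected x -> selected y -> idx x = idx y -> x = y.
Proof.
exists (fun x => pickle (gen x, grid_cell (rho (gen x)) x)) => x y Sx Sy.
by move=> /(pcan_inj pickleK)[xy]; rewrite -xy; exact: selected_cell_inj.
Qed.

(** Finitely many codes for the selected balls that touch the ball at [y] and belong
    to its generation or to an earlier one.  The first component determines the
    generation: directly for the last three generations up to that of [y], by the
    direction from [y] for the earlier ones, whose balls are at least four times as
    large as the ball at [y].  The second one locates the cell relatively to that
    of [y]. *)
Definition neighbour_code y x :
    ('I_3 + {ffun 'I_d -> 'I_(2 * (2 * d.+1)).+1}) *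
    {ffun 'I_d -> 'I_(2 * (4 * d.+1).+1).+1} :=
  (if (gen y - gen x < 3)%N then inl (inord (gen y - gen x))
   else inr [ffun i => int_code (2 * d.+1)
          (Num.floor (((edist x y)^-1 *: (x - y)) ord0 i * D / 2^-1))],
   [ffun i => int_code (4 * d.+1).+1
      (grid_cell (rho (gen x)) x i - grid_cell (rho (gen x)) y i)]).

(** Two selected balls of distinct early generations satisfy the hypotheses of
    [direction_separated], as none of the three centres involved lies in the ball
    of an earlier generation. *)
Let far_codes y x x' : selected y -> selected x -> selected x' ->
  (3 <= gen y - gen x)%N -> (3 <= gen y - gen x')%N -> (gen x < gen x')%N ->
  edist x y <= r x + r y -> edist x' y <= r x' + r y ->
  2^-1 < edist ((edist x y)^-1 *: (x - y)) ((edist x' y)^-1 *: (x' - y)).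
Proof.
move=> Sy Sx Sx' gx gx' xx' xy x'y.
have Fx := selectedF Sx; have Fy := selectedF Sy; have Fx' := selectedF Sx'.
have /andP[ry0 _] := r_bnd Fy.
have far z : F z -> (3 <= gen y - gen z)%N -> 4 * r y <= r z.
  move=> Fz gz; have /andP[h1 _] := genP Fz; have /andP[_ h2] := genP Fy.
  have := @gen_radius_le (gen z).+3 (gen y) (max_radius_ge0 Fz).
  have := gen_radiusS (gen z); have := gen_radiusS (gen z).+1.
  have := gen_radiusS (gen z).+2; move=> e3 e2 e1 /(_ _)/wrap[|h]; first by lia.
  by lra.
apply: (@direction_separated (r y) (r x) (r x')) => //.
- exact: far.
- exact: far.
- exact/ltW/gen_lt_radius.
- by apply: selected_gen_lt => //; lia.
- by apply: selected_gen_lt => //; lia.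
- exact: selected_gen_lt.
Qed.

Lemma neighbour_code_inj y x x' : selected y -> selected x -> selected x' ->
  (gen x <= gen y)%N -> (gen x' <= gen y)%N ->
  edist x y <= r x + r y -> edist x' y <= r x' + r y ->
  neighbour_code y x = neighbour_code y x' -> x = x'.
Proof.
move=> Sy Sx Sx' gx gx' xy x'y [E1 E2].
have Fx := selectedF Sx; have Fy := selectedF Sy; have Fx' := selectedF Sx'.
have gxx' : gen x = gen x'.
  move: E1; case: ltnP => h; case: ltnP => h' //.
    by move=> [/(congr1 val)]; rewrite /= !inordK//; lia.
  move=> [E1].
  have u1 z i : `|((edist z y)^-1 *: (z - y)) ord0 i| <= 1.
    rewrite !mxE normrM ger0_norm ?invr_ge0 ?edist_ge0//.
    have [->|z0] := eqVneq (edist z y) 0; first by rewrite invr0 mul0r.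
    rewrite mulrC ler_pdivrMr ?mul1r; last by rewrite lt_def z0 edist_ge0.
    exact: le_coord_edist.
  (* equal direction codes: mesh 1/2, coordinates of unit vectors in [-1, 1] *)
  have close : edist ((edist x y)^-1 *: (x - y)) ((edist x' y)^-1 *: (x' - y)) < 2^-1.
    apply: grid_cell_lt; first by rewrite invr_gt0.
    apply/ffunP => i; move/ffunP : E1 => /(_ i); rewrite !ffunE.
    have bnd z : `|Num.floor (((edist z y)^-1 *: (z - y)) ord0 i * D / 2^-1)| <=
        (2 * d.+1)%N%:Z.
      apply: floor_norm_le; rewrite invrK -mulrA normrM natrM [2 * _]mulrC.
      rewrite (ger0_norm (_ : 0 <= D * 2))// -[leRHS]mul1r ler_wpM2r//.
    by apply: int_code_inj; exact: bnd.
  case: (ltngtP (gen x) (gen x')) => // lt.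
    by have := far_codes Sy Sx Sx' h h' lt xy x'y; rewrite ltNge (ltW close).
  have := far_codes Sy Sx' Sx h' h lt x'y xy.
  by rewrite edistC ltNge (ltW close).
apply: selected_cell_inj => //; apply/ffunP => i.
(* The centres are at distance at most [4 * rho (gen z)]: [r z] and [r y] are both
   at most twice [rho (gen z)]. *)
have bnd z : F z -> (gen z <= gen y)%N -> edist z y <= r z + r y ->
    `|grid_cell (rho (gen z)) z i - grid_cell (rho (gen z)) y i| <=
    ((4 * d.+1).+1)%N%:Z.
  move=> Fz gz zy; rewrite !ffunE; apply: floor_dist_le.
  have rho0 : 0 < rho (gen z) by exact: gen_radius_gt0 Fz.
  rewrite -mulrBl -mulrBl normrM normrM (ger0_norm (_ : 0 <= D))//.
  rewrite (gtr0_norm (_ : 0 < (rho (gen z))^-1)) ?invr_gt0//.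
  rewrite ler_pdivrMr// natrM mulrAC ler_wpM2r//.
  apply: le_trans (le_coord_edist _ _ _) _; apply: le_trans zy _.
  have /andP[_ h1] := genP Fz; have /andP[_ h2] := genP Fy.
  have := gen_radius_le (max_radius_ge0 Fz) gz; lra.
move/ffunP : E2 => /(_ i); rewrite !ffunE -gxx'.
move=> /int_code_inj H; apply: (@addIr _ (- grid_cell (rho (gen x)) y i)).
have := H; rewrite !ffunE; apply.
- by have := bnd x Fx gx xy; rewrite !ffunE.
- by have := bnd x' Fx' gx' x'y; rewrite !ffunE -gxx'.
Qed.

End Selection.

Definition besicovitch_bound : nat :=
  #|{: ('I_3 + {ffun 'I_d -> 'I_(2 * (2 * d.+1)).+1}) *
       {ffun 'I_d -> 'I_(2 * (4 * d.+1).+1).+1} }|.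

Lemma selected_neighbours (F : set 'rV[R]_d) (r : 'rV[R]_d -> R) (M : R) :
  (forall x, F x -> 0 < r x <= M) ->
  forall y (t : seq 'rV[R]_d), selected F r M y -> uniq t ->
  (forall x, x \in t -> [/\ selected F r M x, (gen r M x <= gen r M y)%N &
                            edist x y <= r x + r y]) ->
  (size t <= besicovitch_bound)%N.
Proof.
move=> rM y t Sy ut tP; rewrite -(size_map (neighbour_code r M y)).
have /card_uniqP <- : uniq (map (neighbour_code r M y) t).
  rewrite map_inj_in_uniq// => x x' /tP[Sx gx xy] /tP[Sx' gx' xy'].
  exact: (neighbour_code_inj rM Sy).
exact: max_card.
Qed.

(** Besicovitch's covering theorem, as it is used: a sum over the selected balls is
    at most a constant times the supremum of the sums over their packings.  The
    decomposition into packings is only made for finite subfamilies, coloured greedily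
    in the order of the generations, since [esum] is a supremum of finite sums. *)
Theorem besicovitch (F : set 'rV[R]_d) (r : 'rV[R]_d -> R) (M : R) :
  (forall x, F x -> 0 < r x <= M) ->
  exists (I : set nat) (c : nat -> 'rV[R]_d),
  [/\ forall i, I i -> F (c i),
      F `<=` \bigcup_(i in I) eball (c i) (r (c i)) &
      forall (f : nat -> \bar R) (b : \bar R), (forall i, 0 <= f i)%E ->
        (forall J, J `<=` I -> trivIset J (fun i => eball (c i) (r (c i))) ->
           \esum_(i in J) f i <= b)%E ->
        (\esum_(i in I) f i <= besicovitch_bound.+1%:R%:E * b)%E].
Proof.
move=> rM; pose S := selected F r M.
have [idx idxI] := selected_countable F r M.
pose I := idx @` S.
pose c n := xget 0 [set x | S x /\ idx x = n].
have cK x : S x -> c (idx x) = x.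
  move=> Sx; apply: idxI => //; rewrite /c.
    by have [] : [set z | S z /\ idx z = idx x] (c (idx x)) by exact: (@xgetI _ 0 _ x).
  by have [] : [set z | S z /\ idx z = idx x] (c (idx x)) by exact: (@xgetI _ 0 _ x).
have IS i : I i -> S (c i) by move=> [x Sx <-]; rewrite cK.
have cI i j : I i -> I j -> c i = c j -> i = j.
  by move=> [x Sx <-] [y Sy <-]; rewrite !cK// => ->.
exists I, c; split.
- by move=> i /IS /selectedF.
- move=> x /(selected_cover rM)[z Sz zx]; exists (idx z); first by exists z.
  by rewrite cK.
move=> f b f0 Jb; apply: ge_ereal_sup => _ [A [finA AI] <-].
have [s us sA] : exists2 s : seq nat, uniq s & A = [set` s].
  move: finA => /finite_seqP[s ->]; exists (undup s); first exact: undup_uniq.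
  by apply/seteqP; split => i /=; rewrite mem_undup.
have {}AI i : i \in s -> I i by move=> si; apply: AI; rewrite sA.
rewrite sA -fsbig_seq//.
pose conf i j := exists z, eball (c i) (r (c i)) z /\ eball (c j) (r (c j)) z.
have [||||col colP] := @greedy_colouring nat I (gen r M \o c) conf
    besicovitch_bound _ _ s _ _.
- by move=> x y [z [? ?]]; exists z.
- move=> j t Ij ut tP; rewrite -(size_map c).
  apply: (selected_neighbours rM (IS _ Ij)).
    by rewrite map_inj_in_uniq// => i i' /tP[Ii _ _] /tP[Ii' _ _]; exact: cI.
  move=> _ /mapP[i /tP[Ii gij [z [iz jz]]] ->]; split => //; first exact: IS.
  apply: le_trans (edist_triangle z _ _) _; rewrite lerD//.
  by rewrite edistC.
- by [].
- exact: AI.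
(* sum over each colour class, which is a packing *)
rewrite (eq_bigr (fun i => \sum_(k < besicovitch_bound.+1 | k == col i) f i)%E).
  rewrite (exchange_big_dep predT)//=.
  apply: (@le_trans _ _ (\sum_(k < besicovitch_bound.+1) b)%E).
    apply: lee_sum => k _.
    pose J := [set` [seq i <- s | k == col i]].
    have JA i : J i -> i \in s /\ k = col i.
      by rewrite /J/= mem_filter => /andP[/eqP].
    rewrite -big_filter fsbig_seq ?filter_uniq //.
    rewrite -esum_fset//; apply: Jb => [i /JA[/AI]//|].
    apply/trivIsetP => i j /JA[Ai ki] /JA[Aj kj] /eqP ij.
    rewrite -subset0 => z [iz jz]; apply: (colP i j) => //; last by rewrite -ki.
    by exists z.
  elim: (besicovitch_bound.+1) => [|n IH]; first by rewrite big_ord0 mul0e.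
  by rewrite big_ord_recr/= -natr1 EFinD ge0_muleDl ?lee_fin// mul1e leeD2r.
by move=> i _; rewrite big_pred1_eq.
Qed.
End Besicovitch.

(** * Masses of balls and outer regularity *)

Section Borel.
Context (R : realType) (d : nat).
Implicit Types (x y : 'rV[R]_d) (m : probability (Rd R d) R).

Lemma open_measurable_Rd (U : set 'rV[R]_d) :
  open U -> measurable (U : set (Rd R d)).
Proof. exact: sub_sigma_algebra. Qed.

Lemma open_oball x (r : R) : open [set y | edist x y < r].
Proof.
apply/open_edistP => y /= xy; exists (r - edist x y); first by rewrite subr_gt0.
by move=> z yz; have := edist_triangle y x z; lra.
Qed.

Lemma measurable_eball x r : measurable (eball x r : set (Rd R d)).
Proof.
rewrite -[eball x r]setCK; apply: measurableC; apply: open_measurable_Rd.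
apply/open_edistP => y /= /negP; rewrite -ltNge => xy.
exists (edist x y - r); first by rewrite subr_gt0.
move=> z yz /=; apply/negP; rewrite -ltNge; have := edist_triangle z x y.
by rewrite (edistC z y); lra.
Qed.

Lemma eball_le x (r s : R) : r <= s -> eball x r `<=` eball x s.
Proof. by move=> rs y /= xy; exact: le_trans rs. Qed.

Lemma probability_fin m (U : set (Rd R d)) :
  measurable U -> m U = (fine (m U))%:E.
Proof. by move=> mU; rewrite fineK// fin_num_measure. Qed.

Lemma measure_bigcap_lt m (F : nat -> set (Rd R d)) (a : \bar R) :
  (forall n, measurable (F n)) -> nonincreasing_seq F ->
  (m (\bigcap_n F n) < a)%E -> exists n, (m (F n) < a)%E.
Proof.
move=> mF niF ma; apply: contrapT => noS.
have mI : measurable (\bigcap_n F n) by exact: bigcapT_measurable.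
have : (m \o F) n @[n --> \oo] --> m (\bigcap_n F n).
  apply: nonincreasing_cvg_mu => //.
  exact: le_lt_trans (probability_le1 m (mF _)) (ltry 1).
move=> c; suff : (a <= m (\bigcap_n F n))%E by rewrite leNgt ma.
rewrite -(cvg_lim _ c)//; apply: lime_ge; first exact: cvgP c.
by apply: nearW => n /=; rewrite leNgt; apply/negP => h; apply: noS; exists n.
Qed.

Lemma measure_bigcup_le m (F : nat -> set (Rd R d)) (b : \bar R) :
  (forall n, measurable (F n)) -> nondecreasing_seq F ->
  (forall n, (m (F n) <= b)%E) -> (m (\bigcup_n F n) <= b)%E.
Proof.
move=> mF ndF mb.
have mU : measurable (\bigcup_n F n) by exact: bigcupT_measurable.
have c : (m \o F) n @[n --> \oo] --> m (\bigcup_n F n).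
  exact: nondecreasing_cvg_mu.
rewrite -(cvg_lim _ c)//; apply: lime_le; first exact: cvgP c.
exact: nearW.
Qed.

Lemma exists_invS_lt (e : R) : 0 < e -> exists n, n.+1%:R^-1 < e.
Proof.
move=> e0; exists (Num.truncn e^-1).
by rewrite invf_plt ?posrE// truncnS_gt.
Qed.

(** A closed ball is the intersection of the larger concentric ones. *)
Lemma eball_rcont m x (r : R) (a : \bar R) : (m (eball x r) < a)%E ->
  exists2 s, r < s & (m (eball x s) < a)%E.
Proof.
have -> : eball x r = \bigcap_n eball x (r + n.+1%:R^-1).
  apply/seteqP; split=> [y xy n _|y xy]; first by apply: eball_le xy; rewrite lerDl.
  rewrite /eball/= leNgt; apply/negP; rewrite -subr_gt0 => /exists_invS_lt[n].
  by rewrite ltrBrDl ltNge; apply/negP/negPn/(xy n).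
move=> /measure_bigcap_lt [n|n p np|n ma]; first exact: measurable_eball.
  by apply/subsetPset/eball_le; rewrite lerD2l lef_pV2 ?posrE// ler_nat.
by exists (r + n.+1%:R^-1) => //; rewrite ltrDl.
Qed.

Definition ball_mass m x (r : R) : R := fine (m (eball x r)).

Lemma ball_massE m x r : m (eball x r) = (ball_mass m x r)%:E.
Proof. apply: probability_fin; exact: measurable_eball. Qed.

Lemma ball_mass_ge0 m x r : 0 <= ball_mass m x r.
Proof. exact: fine_ge0. Qed.

Lemma le_ball_mass m x : {homo ball_mass m x : r s / r <= s}.
Proof.
move=> r s rs; rewrite -lee_fin -!ball_massE; apply: le_measure; rewrite ?inE.
- exact: measurable_eball.
- exact: measurable_eball.
- exact: eball_le.
Qed.

Lemma ball_mass_rcont m x r : ball_mass m x s @[s --> r^'+] --> ball_mass m x r.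
Proof.
apply/cvgrPdist_lt => e e0.
have [|s rs ms] := @eball_rcont m x r (ball_mass m x r + e)%:E.
  by rewrite ball_massE lte_fin ltrDl.
rewrite ball_massE lte_fin in ms.
near=> u; rewrite distrC ger0_norm ?subr_ge0; last exact: le_ball_mass.
rewrite ltrBlDl; apply: le_lt_trans ms; apply: le_ball_mass.
near: u; exact: nbhs_right_le.
Unshelve. all: by end_near. Qed.

(** For fixed [r] the mass of [B(x, r)] is upper semicontinuous in [x], because
    it is right-continuous in [r]. *)
Lemma measurable_ball_mass m r :
  measurable_fun setT (fun x : Rd R d => ball_mass m x r).
Proof.
apply: (measurability _ (measurable_realfun.RGenInftyO.measurableE R)) => _ [_ [a ->] <-].
rewrite setTI; apply: open_measurable_Rd; apply/open_edistP => x /=.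
rewrite in_itv/= => xa.
have [|s rs ms] := @eball_rcont m x r a%:E; first by rewrite ball_massE lte_fin.
rewrite ball_massE lte_fin in ms.
exists (s - r) => [|y xy]; first by rewrite subr_gt0.
rewrite in_itv/=; apply: le_lt_trans ms.
rewrite -lee_fin -!ball_massE; apply: le_measure; rewrite ?inE.
- exact: measurable_eball.
- exact: measurable_eball.
- by move=> z /= yz; rewrite /eball/=; have := edist_triangle y x z; rewrite /eball/= in yz; lra.
Qed.

End Borel.

Section Regularity.
Context (R : realType) (d : nat) (m : probability (Rd R d) R).

(** This class is visibly stable under complement, unlike outer regularity alone. *)
Definition approximable : set (set 'rV[R]_d) :=
  [set A | forall e : R, 0 < e -> exists U V : set 'rV[R]_d,
     [/\ open U, open V, A `<=` U, ~` A `<=` V & (m (U `&` V) < e%:E)%E]].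

Lemma open_approximable : open `<=` approximable.
Proof.
move=> U oU e e0.
pose V n := [set y : 'rV[R]_d | exists2 z, ~ U z & edist z y < n.+1%:R^-1].
have oV n : open (V n).
  apply/open_edistP => y [z nUz zy]; exists (n.+1%:R^-1 - edist z y).
    by rewrite subr_gt0.
  move=> w yw; exists z => //.
  by apply: le_lt_trans (edist_triangle y z w) _; rewrite -ltrBrDl.
have [n|||n mn] := @measure_bigcap_lt _ _ m (fun n => U `&` V n) e%:E.
- by apply: measurableI; exact: open_measurable_Rd.
- move=> n p np; apply/subsetPset => y [Uy [z nUz zy]]; split => //; exists z => //.
  by apply: lt_le_trans zy _; rewrite lef_pV2 ?posrE// ler_nat.
- rewrite (_ : \bigcap_n _ = set0) ?measure0 ?lte_fin// -subset0 => y UV.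
  have [Uy _] := UV 0%N I.
  have [a a0 Ua] := (open_edistP U).1 oU y Uy.
  have [n na] := exists_invS_lt a0.
  have [_ [z nUz zy]] := UV n I; apply: nUz; apply: Ua; rewrite edistC.
  exact: lt_trans na.
- exists U, (V n); split => // y nUy; exists y => //.
  by rewrite edistxx invr_gt0.
Qed.

(** In a countable union the open sets around the complements must be intersected,
    and only finite intersections are open: continuity from above of the measure
    allows one to stop at a finite stage. *)
Lemma approximable_sigma_algebra : sigma_algebra setT approximable.
Proof.
split => [e e0|A GA e e0|A GA e e0].
- exists set0, setT; split; [exact: open0|exact: openT|by []|by []|].
  by rewrite set0I measure0 lte_fin.
- have [U [V [oU oV AU AV UV]]] := GA e e0.
  exists V, U; split => //; first by rewrite setTD.
    by rewrite setTD setCK.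
  by rewrite setIC.
have e20 n : 0 < e / 2 / (2 ^ n.+1)%:R.
  by rewrite !divr_gt0// ltr0n expn_gt0.
have /choice[UV UVP] : forall n, exists UV : set 'rV[R]_d * set 'rV[R]_d,
    [/\ open UV.1, open UV.2, A n `<=` UV.1, ~` A n `<=` UV.2 &
       (m (UV.1 `&` UV.2) < (e / 2 / (2 ^ n.+1)%:R)%:E)%E].
  by move=> n; have [U [V H]] := GA n _ (e20 n); exists (U, V).
pose U := \bigcup_n (UV n).1.
pose W n := [set y | forall k, (k <= n)%N -> (UV k).2 y].
have oU : open U by apply: bigcup_open => n _; case: (UVP n).
have oW n : open (W n).
  elim: n => [|n IH].
    rewrite (_ : W 0%N = (UV 0%N).2); first by case: (UVP 0%N).
    apply/seteqP; split=> y; first exact.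
    by move=> Vy k; rewrite leqn0 => /eqP->.
  rewrite (_ : W n.+1 = W n `&` (UV n.+1).2).
    by apply: openI => //; case: (UVP n.+1).
  apply/seteqP; split=> y.
    by move=> Wy; split; [move=> k /leqW; exact: Wy|exact: Wy].
  by move=> [Wy Vy] k; rewrite leq_eqVlt => /predU1P[->//|]; rewrite ltnS; exact: Wy.
have [n|||n mn] := @measure_bigcap_lt _ _ m (fun n => U `&` W n) e%:E.
- by apply: measurableI; exact: open_measurable_Rd.
- by move=> n p np; apply/subsetPset => y [Uy Wy]; split=> // k kn; apply: Wy; exact: leq_trans np.
- apply: (@le_lt_trans _ _ (e / 2)%:E); last first.
    by rewrite lte_fin ltr_pdivrMr// ltr_pMr// ltr1n.
  apply: le_trans (epsilon_trick0 _ _); last by rewrite divr_ge0// ltW.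
  apply: (@le_trans _ _ (\sum_(n <oo) m ((UV n).1 `&` (UV n).2))%E); last first.
    by apply: lee_nneseries => // n _; apply/ltW; case: (UVP n).
  have mUV n : measurable ((UV n).1 `&` (UV n).2 : set (Rd R d)).
    by case: (UVP n) => *; apply: measurableI; exact: open_measurable_Rd.
  apply: measure_sigma_subadditive => //.
    apply: bigcapT_measurable => n; apply: measurableI; exact: open_measurable_Rd.
  move=> y UW; have [[n _ Uy] _] := UW 0%N I; exists n => //; split => //.
  by have [_] := UW n I; apply.
- exists U, (W n); split => //.
    by apply: subset_bigcup => k _; case: (UVP k).
  rewrite setC_bigcup => y Ay k kn.
  by case: (UVP k) => _ _ _ + _; apply; exact: Ay.
Qed.

(** Every finite Borel measure on a metric space is outer regular: the sets that
    are squeezed, up to small mass, between open supersets of themselves and of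
    their complements form a sigma-algebra. *)
Lemma outer_regular (A : set (Rd R d)) (e : R) : measurable A -> 0 < e ->
  exists U : set 'rV[R]_d, [/\ open U, A `<=` U & (m U <= m A + e%:E)%E].
Proof.
move=> mA e0.
have [U [V [oU oV AU AV UV]]] : exists U V : set 'rV[R]_d,
     [/\ open U, open V, A `<=` U, ~` A `<=` V & (m (U `&` V) < e%:E)%E].
  by apply: (smallest_sub approximable_sigma_algebra open_approximable mA).
exists U; split => //.
have mU := open_measurable_Rd oU; have mV := open_measurable_Rd oV.
apply: (@le_trans _ _ (m (A `|` (U `&` V)))).
  apply: le_measure; rewrite ?inE//.
    by apply: measurableU => //; exact: measurableI.
  by move=> x Ux; have [?|/AV] := pselect (A x); [left|right].
apply: le_trans (measureU2 _ _ _) _ => //; first exact: measurableI.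
by rewrite leeD2l// ltW.
Qed.

End Regularity.

Section GaugeInequality.
Context (R : realType).
Implicit Types (a p : R).

(** The exponent is nonnegative, so [a = 0] is allowed: the limit measure of a ball
    may vanish. *)
Lemma cvg_powR (T : Type) (F : set_system T) (FF : Filter F) (f : T -> R) a p :
  (forall x, 0 <= f x) -> 0 <= p -> f x @[x --> F] --> a ->
  f x `^ p @[x --> F] --> a `^ p.
Proof.
move=> f0 p0 fa; have [->|pn0] := eqVneq p 0.
  rewrite powRr0; under eq_fun do rewrite powRr0; exact: cvg_cst.
have {}p0 : 0 < p by rewrite lt_def pn0.
have [a0|a0|a0E] := ltgtP 0 a.
- suff c : {for a, continuous (@powR R ^~ p)} by exact: (continuous_cvg _ c fa).
  apply/differentiable_continuous/derivable1_diffP/derivable_powR.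
  by rewrite in_itv/= a0.
- have /cvgrPdist_lt/(_ (- a)) := fa; rewrite oppr_gt0 => /(_ a0) H.
  apply/cvgrPdist_lt => e e0; near=> x; exfalso.
  have : `|a - f x| < - a by near: x.
  rewrite ltr0_norm ?subr_lt0 ?(lt_le_trans a0)// opprB => h.
  by have := f0 x; lra.
rewrite -a0E in fa *; rewrite powR0 ?gt_eqF//; apply/cvgrPdist_lt => e e0.
have e'0 : 0 < e `^ p^-1 by exact: powR_gt0.
near=> x; rewrite sub0r normrN ger0_norm ?powR_ge0//.
rewrite -[ltRHS]powRr1 ?ltW// -[X in _ < _ `^ X](mulVf (lt0r_neq0 p0)) powRrM.
apply: gt0_ltr_powR; rewrite ?nnegrE ?powR_ge0//.
have : `|0 - f x| < e `^ p^-1.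
  near: x; apply: cvgr_dist_lt => //; exact: fa.
by rewrite sub0r normrN ger0_norm.
Unshelve. all: by end_near. Qed.

Lemma near_at_rightP (x : R) (P : set R) : (\forall u \near x^'+, P u) <->
  exists2 c, x < c & forall u, x < u < c -> P u.
Proof.
split=> [|[c xc cP]].
  move=> /nbhs_ballP[e /= e0 eP]; exists (x + e); first by rewrite ltrDl.
  move=> u /andP[xu ue]; apply: eP => //; rewrite /ball/= distrC.
  by rewrite gtr0_norm ?subr_gt0// ltrBlDl.
near=> u; apply: cP; apply/andP; split; near: u.
  exact: nbhs_right_gt.
exact: nbhs_right_lt.
Unshelve. all: by end_near. Qed.

Lemma cvg_prod_seq (T I : Type) (F : set_system T) (FF : Filter F) (s : seq I)
    (f : I -> T -> R) (l : I -> R) :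
  (forall i, f i x @[x --> F] --> l i) ->
  \prod_(i <- s) f i x @[x --> F] --> \prod_(i <- s) l i.
Proof.
move=> fl; elim: s => [|i s IH].
  by rewrite big_nil; under eq_fun do rewrite big_nil; exact: cvg_cst.
by rewrite big_cons; under eq_fun do rewrite big_cons; exact: cvgM.
Qed.

(** With [p = expo_pos p - expo_neg p], a power of real exponent becomes a quotient of
    two powers that are monotone and continuous on [0, +oo[, zero included. *)
Definition expo_pos p := Num.max p 0.
Definition expo_neg p := Num.max (- p) 0.

Lemma expo_pos_ge0 p : 0 <= expo_pos p. Proof. by rewrite le_max lexx orbT. Qed.
Lemma expo_neg_ge0 p : 0 <= expo_neg p. Proof. by rewrite le_max lexx orbT. Qed.

Lemma epow_expo_pos_neg a p : 0 <= a -> (0 < a) || (0 <= p) ->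
  epow a%:E p = (a `^ expo_pos p / a `^ expo_neg p)%:E.
Proof.
move=> a0 ap; rewrite /epow eqe ifF; last first.
  apply/negP => /andP[/eqP a00 p0]; move: ap.
  by rewrite a00 ltxx leNgt p0.
rewrite poweR_EFin /expo_pos /expo_neg; congr EFin; have [p0|p0] := leP 0 p.
  by rewrite max_r ?oppr_le0// powRr0 divr1.
by rewrite max_l ?oppr_ge0 ?(ltW p0)// powRr0 mul1r powRN invrK.
Qed.

Lemma epow_ge0 (x : \bar R) p : (0 <= epow x p)%E.
Proof. by rewrite /epow; case: ifP => // _; exact: poweR_ge0. Qed.

End GaugeInequality.

Section Gauge.
Context (R : realType) (d k : nat).
Variables (mu : 'I_k -> probability (Rd R d) R) (nu : probability (Rd R d) R).
Variables (q : 'I_k -> R) (t : R) (theta : probability (Rd R d) R).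
Implicit Types (x : 'rV[R]_d) (r s : R).

Local Notation gauge := (gauge mu nu q t).

Lemma gauge_ge0 x r : (0 <= gauge x r)%E.
Proof.
rewrite /gauge mule_ge0 ?epow_ge0//; elim/big_ind: _ => // [|i _].
  by move=> a b a0 b0; exact: mule_ge0.
exact: epow_ge0.
Qed.

(** The inequality [s * gauge <= theta] between masses of balls, with every factor of
    negative exponent moved to the right-hand side. *)
Definition gauge_side s x r : R :=
  s * (\prod_(i < k) ball_mass (mu i) x r `^ expo_pos (q i)) * ball_mass nu x r `^ expo_pos t.
Definition mass_side x r : R :=
  ball_mass theta x r *
  ((\prod_(i < k) ball_mass (mu i) x r `^ expo_neg (q i)) * ball_mass nu x r `^ expo_neg t).

(** If [nu] gives no mass to the ball and [t < 0], the gauge is infinite and the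
    inequality fails; so does the second one, whose right-hand side is then 0 while
    its left-hand side is positive. *)
Lemma gauge_le_mass s x r : 0 < s -> (forall i, 0 < ball_mass (mu i) x r) ->
  (s%:E * gauge x r <= theta (eball x r))%E = (gauge_side s x r <= mass_side x r).
Proof.
move=> s0 mu0; rewrite ball_massE /gauge ball_massE.
have E i : epow (mu i (eball x r)) (q i) =
    (ball_mass (mu i) x r `^ expo_pos (q i) / ball_mass (mu i) x r `^ expo_neg (q i))%:E.
  by rewrite ball_massE epow_expo_pos_neg ?mu0 ?ball_mass_ge0.
rewrite (eq_bigr _ (fun i _ => E i)).
rewrite prodEFin big_split/= prodfV /gauge_side /mass_side.
set a := \prod_(i < k) _; set b := \prod_(i < k) _.
have a0 : 0 < a by apply: prodr_gt0 => i _; exact: powR_gt0.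
have b0 : 0 < b by apply: prodr_gt0 => i _; exact: powR_gt0.
have n0 := ball_mass_ge0 nu x r; set n := ball_mass nu x r in n0 *.
have [nt|] := boolP ((0 < n) || (0 <= t)).
  have n'0 : 0 < n `^ expo_neg t.
    move: nt => /orP[/powR_gt0//|t0].
    by rewrite /expo_neg max_r ?oppr_le0// powRr0.
  rewrite epow_expo_pos_neg// -!EFinM lee_fin.
  have -> : s * (a / b * (n `^ expo_pos t / n `^ expo_neg t)) =
    s * a * n `^ expo_pos t / (b * n `^ expo_neg t) by field; rewrite !gt_eqF.
  by rewrite ler_pdivrMr// mulr_gt0.
rewrite negb_or -leNgt -ltNge => /andP[n0' t0].
have nE : n = 0 by apply/eqP; rewrite eq_le n0 n0'.
rewrite nE /epow eqxx t0/= gt0_muley ?lte_fin ?divr_gt0// gt0_muley ?lte_fin//.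
have pt : expo_pos t = 0 by rewrite /expo_pos max_r// ltW.
have nt : expo_neg t = - t by rewrite /expo_neg max_l// oppr_ge0 ltW.
rewrite leye_eq/= pt nt powRr0 mulr1 (@powR0 _ (- t)) ?oppr_eq0 ?lt_eqF//.
rewrite !mulr0.
  by apply/esym/negbTE; rewrite -ltNge mulr_gt0.
exact: ltry.
Qed.

Lemma gauge_side_le s x r r' : 0 <= s -> r <= r' -> gauge_side s x r <= gauge_side s x r'.
Proof.
move=> s0 rr'; have H m p : ball_mass m x r `^ expo_pos p <= ball_mass m x r' `^ expo_pos p.
  by apply: ge0_ler_powR; rewrite ?nnegrE ?expo_pos_ge0 ?ball_mass_ge0// le_ball_mass.
apply: ler_pM; last exact: H.
- by rewrite mulr_ge0// prodr_ge0// => i _; exact: powR_ge0.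
- exact: powR_ge0.
- by rewrite ler_wpM2l// ler_prod// => i _; rewrite powR_ge0/=; exact: H.
Qed.

Lemma mass_side_rcont x r : mass_side x r' @[r' --> r^'+] --> mass_side x r.
Proof.
have H m p : ball_mass m x r' `^ expo_neg p @[r' --> r^'+] --> ball_mass m x r `^ expo_neg p.
  by apply: cvg_powR; [move=> u; exact: ball_mass_ge0|exact: expo_neg_ge0|exact: ball_mass_rcont].
apply: cvgM; first exact: ball_mass_rcont.
by apply: cvgM; [apply: cvg_prod_seq => i; exact: H|exact: H].
Qed.

(** If the inequality failed at [r], then right-continuity of the right-hand side
    and monotonicity of the left-hand side would make it fail at all slightly larger
    radii, in particular at rational ones. *)
Lemma gauge_side_le_rat s x r (b : R) : 0 <= s -> r < b ->
  (forall p : rat, r < ratr p < b -> gauge_side s x (ratr p) <= mass_side x (ratr p)) ->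
  gauge_side s x r <= mass_side x r.
Proof.
move=> s0 rb H; rewrite leNgt; apply/negP => lr.
have /cvgrPdist_lt/(_ (gauge_side s x r - mass_side x r)) := @mass_side_rcont x r.
rewrite subr_gt0 => /(_ lr) N.
have [c rc cP] := (near_at_rightP _ _).1 N.
have [p] : exists p : rat, ratr p \in `]r, Num.min b c[.
  by apply: rat_in_itvoo; rewrite lt_min rb.
rewrite in_itv/= lt_min => /and3P[rp pb pc].
have := cP (ratr p); rewrite rp pc => /(_ isT); rewrite ltr_norml => /andP[h _].
have := H p; rewrite rp pb => /(_ isT).
have := gauge_side_le x s0 (ltW rp); lra.
Qed.

Lemma measurable_gauge_side s r : measurable_fun setT (fun x : Rd R d => gauge_side s x r).
Proof.
have H m p : measurable_fun setT (fun x : Rd R d => ball_mass m x r `^ p).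
  apply: (@measurableT_comp _ _ _ _ _ _ (@powR R ^~ p)) => //.
  exact: measurable_ball_mass.
apply: measurable_funM; last exact: H.
apply: measurable_funM; first exact: measurable_cst.
by apply: measurable_prod => i _; exact: H.
Qed.

Lemma measurable_mass_side r : measurable_fun setT (fun x : Rd R d => mass_side x r).
Proof.
have H m p : measurable_fun setT (fun x : Rd R d => ball_mass m x r `^ p).
  apply: (@measurableT_comp _ _ _ _ _ _ (@powR R ^~ p)) => //.
  exact: measurable_ball_mass.
apply: measurable_funM; first exact: measurable_ball_mass.
apply: measurable_funM; last exact: H.
by apply: measurable_prod => i _; exact: H.
Qed.

End Gauge.

(** * Comparison of theta with the two measures *)

Local Open Scope ereal_scope.

Section MassSums.
Context (R : realType) (d : nat) (m : probability (Rd R d) R).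

(** The balls of a packing inside [U] are disjoint, so their masses add up to at most
    that of [U]. *)
Lemma packing_mass (J : set nat) (B : nat -> set (Rd R d)) (f : nat -> \bar R)
    (U : set (Rd R d)) (s : R) :
  (0 < s)%R -> (forall i, measurable (B i)) -> trivIset J B -> measurable U ->
  (forall i, J i -> B i `<=` U) -> (forall i, 0 <= f i) ->
  (forall i, J i -> s%:E * f i <= m (B i)) ->
  s%:E * (\esum_(i in J) f i) <= m U.
Proof.
move=> s0 mB tB mU BU f0 sf.
rewrite muleC -lee_pdivlMr// muleC.
apply: (@le_trans _ _ (\esum_(i in J) (s^-1%:E * m (B i)))).
  by apply: le_esum => i Ji; rewrite lee_pdivlMl// sf.
rewrite -[J in esum J _]set_mem_set -nneseries_esum; last first.
  by move=> i _; rewrite mule_ge0// lee_fin invr_ge0 ltW.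
rewrite nneseriesZl// lee_wpmul2l ?lee_fin ?invr_ge0 ?(ltW s0)//.
rewrite -measure_bigcup//; apply: le_measure; rewrite ?inE//.
  exact: bigcup_measurable.
by move=> x [i Ji]; exact: BU.
Qed.

Lemma covering_mass (I : set nat) (B : nat -> set (Rd R d)) (f : nat -> \bar R)
    (s : R) :
  (0 < s)%R -> (forall i, measurable (B i)) -> (forall i, 0 <= f i) ->
  (forall i, I i -> m (B i) <= s%:E * f i) ->
  m (\bigcup_(i in I) B i) <= s%:E * (\esum_(i in I) f i).
Proof.
move=> s0 mB f0 sf; rewrite bigcup_mkcond.
have mB' i : measurable (if i \in I then B i else set0) by case: ifP.
apply: (@le_trans _ _ (\sum_(i <oo) m (if i \in I then B i else set0))).
  by apply: measure_sigma_subadditive => //; exact: bigcupT_measurable.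
rewrite -[I in esum I _]set_mem_set -nneseries_esum// -nneseriesZl//.
rewrite [leRHS]eseries_mkcond; apply: lee_nneseries => // i _.
by case: ifP => [/set_mem/sf//|]; rewrite measure0.
Qed.

Lemma disjoint_mass (B : nat -> set (Rd R d)) (U : set (Rd R d)) :
  (forall i, measurable (B i)) -> trivIset setT B -> measurable U ->
  (forall i, B i `<=` U) -> \sum_(i <oo) m (B i) <= m U.
Proof.
move=> mB tB mU BU; rewrite -measure_semi_bigcup//; last exact: bigcupT_measurable.
apply: le_measure; rewrite ?inE//; first exact: bigcupT_measurable.
by move=> x [i _]; exact: BU.
Qed.

End MassSums.

Section Densities.
Context (R : realType) (d k : nat).
Variables (mu : 'I_k -> probability (Rd R d) R) (nu : probability (Rd R d) R).
Variables (q : 'I_k -> R) (t : R) (theta : probability (Rd R d) R).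
Implicit Types (x : 'rV[R]_d) (r s : R) (E : set 'rV[R]_d).

Local Notation gauge := (gauge mu nu q t).
Local Notation ratio := (density_ratio mu nu q t theta).
Local Notation udensity := (udensity mu nu q t theta).
Local Notation ldensity := (ldensity mu nu q t theta).
Local Notation Hdelta := (Hdelta mu nu q t).
Local Notation Hbar := (Hbar mu nu q t).
Local Notation Hmeas := (Hmeas mu nu q t).
Local Notation Pdelta := (Pdelta mu nu q t).
Local Notation Pbar := (Pbar mu nu q t).
Local Notation Pmeas := (Pmeas mu nu q t).

Lemma ratio_ge0 x r : 0 <= ratio x r.
Proof. by rewrite /density_ratio mule_ge0// inve_ge0 gauge_ge0. Qed.

(** Here and in [ratio_lt] the gauge may be 0 or infinite, and the conventions on
    the quotient still lead to the expected inequality. *)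
Lemma ratio_gt x r s : (0 < s)%R -> s%:E < ratio x r ->
  s%:E * gauge x r <= theta (eball x r).
Proof.
move=> s0; rewrite /density_ratio ball_massE.
have := gauge_ge0 mu nu q t x r; case: (gauge x r) => [g||]//; last first.
  by move=> _; rewrite invey mule0 lte_fin ltNge ltW.
rewrite lee_fin le_eqVlt => /predU1P[<-|g0].
  by rewrite mule0 lee_fin ball_mass_ge0.
rewrite inver gt_eqF// -EFinM lte_fin ltr_pdivlMr// => /ltW.
by rewrite -EFinM lee_fin.
Qed.

Lemma ratio_lt x r s : (0 < s)%R -> ratio x r < s%:E ->
  theta (eball x r) <= s%:E * gauge x r.
Proof.
move=> s0; rewrite /density_ratio ball_massE.
have := gauge_ge0 mu nu q t x r; case: (gauge x r) => [g||]//; last first.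
  by move=> _ _; rewrite gt0_muley ?lte_fin ?leey.
rewrite lee_fin le_eqVlt => /predU1P[<-|g0].
  rewrite inve0 mule0; have := ball_mass_ge0 theta x r.
  by rewrite le_eqVlt => /predU1P[<-//|th0]; rewrite gt0_muley ?lte_fin// ltNge leey.
rewrite inver gt_eqF// -EFinM lte_fin ltr_pdivrMr// => /ltW.
by rewrite -EFinM lee_fin.
Qed.

Lemma udensity_lt x s : udensity x < s%:E ->
  exists2 c : R, (0 < c)%R & forall r, (0 < r < c)%R -> ratio x r < s%:E.
Proof.
rewrite /udensity limf_esupE => /ereal_inf_lt[_ [V /near_at_rightP[c c0 cV] <-] Vs].
exists c => // r rc; apply: le_lt_trans Vs; apply: ereal_sup_ubound.
by exists r => //; exact: cV.
Qed.

Lemma udensity_gt x s c : s%:E < udensity x -> (0 < c)%R ->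
  exists2 r, (0 < r < c)%R & s%:E < ratio x r.
Proof.
rewrite /udensity limf_esupE => su c0.
have : s%:E < ereal_sup [set ratio x r | r in [set r | (0 < r < c)%R]].
  apply: lt_le_trans su _; apply: ereal_inf_lbound.
  by exists [set r | (0 < r < c)%R] => //; apply/near_at_rightP; exists c.
by move=> /ereal_sup_gt[_ [r rc <-]]; exists r.
Qed.

Lemma ldensity_lt x s c : ldensity x < s%:E -> (0 < c)%R ->
  exists2 r, (0 < r < c)%R & ratio x r < s%:E.
Proof.
rewrite /ldensity limf_einfE => su c0.
have : ereal_inf [set ratio x r | r in [set r | (0 < r < c)%R]] < s%:E.
  apply: le_lt_trans su; apply: ereal_sup_ubound.
  by exists [set r | (0 < r < c)%R] => //; apply/near_at_rightP; exists c.
by move=> /ereal_inf_lt[_ [r rc <-]]; exists r.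
Qed.

Lemma ldensity_gt x s : s%:E < ldensity x ->
  exists2 c : R, (0 < c)%R & forall r, (0 < r < c)%R -> s%:E < ratio x r.
Proof.
rewrite /ldensity limf_einfE => /ereal_sup_gt[_ [V /near_at_rightP[c c0 cV] <-] Vs].
exists c => // r rc; apply: lt_le_trans Vs _; apply: ereal_inf_lbound.
by exists r => //; exact: cV.
Qed.

Lemma lee_pmul2l_addgt0 (a b : \bar R) (c : R) : (0 < c)%R ->
  (forall e : R, (0 < e)%R -> a <= c%:E * (b + e%:E)) -> a <= c%:E * b.
Proof.
move=> c0 H; rewrite muleC -lee_pdivrMr// muleC.
by apply/lee_addgt0Pr => e /H; rewrite lee_pdivrMl.
Qed.

Lemma Hmeas_ge0 E : 0 <= Hmeas E.
Proof.
apply: (@le_trans _ _ (Hdelta 1 E)).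
  apply: le_ereal_inf_tmp => _ [I [x [r [_ ->]]]].
  by apply: esum_ge0 => i _; exact: gauge_ge0.
apply: (@le_trans _ _ (Hbar E)); apply: ereal_sup_ubound; first by exists 1%R; rewrite /= ?ltr01.
by exists E.
Qed.

Lemma Pdelta_ge0 c E : 0 <= Pdelta c E.
Proof.
apply: ereal_sup_ubound; exists set0, (fun=> 0%R), (fun=> 0%R); split.
  by split => //; exact: trivIset_set0.
by rewrite esum_set0.
Qed.

Lemma Pbar_ge0 E : 0 <= Pbar E.
Proof. by apply: le_ereal_inf_tmp => _ [c _ <-]; exact: Pdelta_ge0. Qed.

Lemma Pmeas_ge0 E : 0 <= Pmeas E.
Proof.
apply: le_ereal_inf_tmp => _ [F _ <-].
by apply: nneseries_ge0 => n _ _; exact: Pbar_ge0.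
Qed.

Local Notation N := (besicovitch_bound d).+1.

(** The balls supplied by the upper density are chosen inside an open set of almost
    the mass of [E]; Besicovitch's theorem makes a covering out of them whose
    packings have mass at most that of the open set. *)
Lemma Hmeas_le s E : (0 < s)%R -> measurable (E : set (Rd R d)) ->
  (forall x, E x -> s%:E < udensity x) -> s%:E * Hmeas E <= N%:R%:E * theta E.
Proof.
move=> s0 mE Es; apply: lee_pmul2l_addgt0; first by rewrite ltr0n.
move=> e e0; rewrite muleC -lee_pdivlMr// muleC.
apply: ge_ereal_sup => _ [F FE <-]; apply: ge_ereal_sup => _ [dl /= dl0 <-].
have [U [oU EU Ue]] := outer_regular theta mE e0.
have /choice[r rP] : forall x, exists r, F x ->
    [/\ (0 < r <= dl)%R, eball x r `<=` U & s%:E * gauge x r <= theta (eball x r)].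
  move=> x; have [Fx|] := pselect (F x); last by exists 0%R.
  have [c c0 cU] := (open_edistP U).1 oU x (EU _ (FE _ Fx)).
  have [|r /andP[r0 rc] sr] := udensity_gt (Es _ (FE _ Fx)) (_ : 0 < Num.min c dl)%R.
    by rewrite lt_min c0.
  move: rc; rewrite lt_min => /andP[rc rdl].
  exists r => _; split; first by rewrite r0 ltW.
    by move=> y /= xy; apply: cU; exact: le_lt_trans rc.
  exact: ratio_gt.
have [I [c [Ic Fc bes]]] := @besicovitch R d F r dl (fun x Fx => let: And3 h _ _ := rP x Fx in h).
apply: (@le_trans _ _ (\esum_(i in I) gauge (c i) (r (c i)))).
  apply: ereal_inf_lbound; exists I, c, (r \o c); split => //; split => // i Ii.
  by split; [exact: Ic|case: (rP _ (Ic _ Ii))].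
apply: le_trans (bes _ (s^-1%:E * theta U) _ _) _ => [i|J JI tJ|].
- exact: gauge_ge0.
- rewrite lee_pdivlMl//; apply: packing_mass tJ _ _ _ _ => //.
  + by move=> i; exact: measurable_eball.
  + exact: open_measurable_Rd.
  + by move=> i /JI /Ic /rP[].
  + by move=> i; exact: gauge_ge0.
  + by move=> i /JI /Ic /rP[].
- rewrite muleCA lee_wpmul2l ?lee_fin ?invr_ge0 ?(ltW s0)//.
  by rewrite lee_wpmul2l ?lee_fin.
Qed.

(** The sets [En n], which increase to [E], are enclosed in Borel sets, the unions
    [W n] of the balls of nearly optimal coverings; [E] is then contained in the
    lower limit of the [W n]. *)
Lemma theta_le_Hmeas s E : (0 < s)%R -> measurable (E : set (Rd R d)) ->
  (forall x, E x -> udensity x < s%:E) -> Hmeas E < +oo ->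
  theta E <= s%:E * Hmeas E.
Proof.
move=> s0 mE Es Hoo; apply: lee_pmul2l_addgt0 => // e e0.
pose En n := [set x | E x /\ forall r, (0 < r <= n.+1%:R^-1)%R ->
   theta (eball x r) <= s%:E * gauge x r].
have H0 n : (0 < n.+1%:R^-1 :> R)%R by rewrite invr_gt0.
have Hbar_fin n : Hdelta n.+1%:R^-1 (En n) < Hmeas E + e%:E.
  apply: (@le_lt_trans _ _ (Hmeas E)); last first.
    by rewrite lteDl ?lte_fin// ge0_fin_numE// Hmeas_ge0.
  apply: (@le_trans _ _ (Hbar (En n))).
    by apply: ereal_sup_ubound; exists (n.+1%:R^-1)%R => //; exact: H0.
  by apply: ereal_sup_ubound; exists (En n) => // x [].
have /choice[W WP] : forall n, exists W : set (Rd R d),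
    [/\ measurable W, En n `<=` W & theta W <= s%:E * (Hmeas E + e%:E)].
  move=> n; have /ereal_inf_lt[_ [I [c [r [[Icr Ec] ->]]]] Ie] := Hbar_fin n.
  exists (\bigcup_(i in I) eball (c i) (r i)); split => //.
    by apply: bigcup_measurable => i _; exact: measurable_eball.
  apply: (@le_trans _ _ (s%:E * (\esum_(i in I) gauge (c i) (r i)))); last first.
    by rewrite lee_wpmul2l ?lee_fin ?(ltW s0)// ltW.
  apply: covering_mass => // [i|i|i Ii]; first exact: measurable_eball.
    exact: gauge_ge0.
  by have [[_ +] ri] := Icr i Ii; apply.
pose V n := \bigcap_(j in [set j | (n <= j)%N]) W j.
have mV n : measurable (V n).
  by apply: bigcap_measurableType => j _; case: (WP j).
have EV : E `<=` \bigcup_n V n.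
  move=> x Ex; have [c c0 cP] := udensity_lt (Es _ Ex).
  have [n nc] := exists_invS_lt c0; exists n => // j /= nj.
  case: (WP j) => _ + _; apply; split => // r /andP[r0 rj].
  apply: ratio_lt => //; apply: cP; rewrite r0 (le_lt_trans _ nc)//.
  by apply: le_trans rj _; rewrite lef_pV2 ?posrE// ler_nat.
apply: (@le_trans _ _ (theta (\bigcup_n V n))).
  by apply: le_measure; rewrite ?inE//; exact: bigcupT_measurable.
apply: measure_bigcup_le => // [n j nj|n].
  by apply/subsetPset => x Vx i /= ji; apply: Vx => /=; exact: leq_trans ji.
case: (WP n) => mW _; apply: le_trans; apply: le_measure; rewrite ?inE//.
by move=> x; apply => /=.
Qed.

(** A double sequence of sets, enumerated by a bijection, is a cover as in the
    definition of [Pmeas]. *)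
Lemma Pmeas_le_double E (F : nat -> nat -> set 'rV[R]_d) :
  E `<=` \bigcup_n \bigcup_j F n j ->
  Pmeas E <= \sum_(n <oo) \sum_(j <oo) Pbar (F n j).
Proof.
move=> EF; have /card_esym/ppcard_eqP[f] := card_nat2.
apply: (@le_trans _ _ (\sum_(i <oo) Pbar (F (f i).1 (f i).2))).
  apply: ereal_inf_lbound; exists (fun i => F (f i).1 (f i).2) => //.
  move=> x /EF[n _ [j _ Fx]]; exists (f^-1%FUN (n, j)) => //=.
  by rewrite invK ?inE.
rewrite nneseries_esumT; last by move=> i; exact: Pbar_ge0.
rewrite nneseries_esumT; last first.
  by move=> i; apply: nneseries_ge0 => *; exact: Pbar_ge0.
rewrite [leRHS](_ : _ = \esum_(n in [set: nat]) \esum_(j in [set: nat]) Pbar (F n j)).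
  rewrite esum_esum; last by move=> *; exact: Pbar_ge0.
  rewrite (_ : _ `*`` _ = [set: nat * nat]); last by apply/seteqP; split.
  by rewrite (@reindex_esum _ _ _ setT setT f).
apply: eq_esum => n _; rewrite nneseries_esumT// => j; exact: Pbar_ge0.
Qed.

Lemma Pmeas_sigma_subadditive E (A : nat -> set 'rV[R]_d) :
  E `<=` \bigcup_n A n -> Pmeas E <= \sum_(n <oo) Pmeas (A n).
Proof.
move=> EA; have [[i ioo]|] := pselect (exists i, Pmeas (A i) = +oo).
  rewrite (eseries_pinfty _ _ ioo) ?leey// => n _.
  by rewrite -ltNye (lt_le_trans _ (Pmeas_ge0 _)).
rewrite -forallNE => Aoo; apply/lee_addgt0Pr => e e0.
apply: le_trans (epsilon_trick _ _ (ltW e0)); last by move=> n; exact: Pmeas_ge0.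
have /choice[F FP] : forall n, exists F : nat -> set 'rV[R]_d,
    A n `<=` \bigcup_j F j /\
    \sum_(j <oo) Pbar (F j) <= Pmeas (A n) + (e / (2 ^ n.+1)%:R)%:E.
  move=> n.
  have : Pmeas (A n) < Pmeas (A n) + (e / (2 ^ n.+1)%:R)%:E.
    rewrite lteDl ?lte_fin ?divr_gt0 ?ltr0n ?expn_gt0//.
    by rewrite ge0_fin_numE ?Pmeas_ge0// ltey; apply/eqP/Aoo.
  by move=> /ereal_inf_lt[_ [F AF <-] /ltW Fe]; exists F.
apply: (@le_trans _ _ (\sum_(n <oo) \sum_(j <oo) Pbar (F n j))).
  apply: Pmeas_le_double => x /EA[n _ Anx]; exists n => //.
  exact: (FP n).1.
apply: lee_nneseries => [n _ _|n _]; last by case: (FP n).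
by apply: nneseries_ge0 => *; exact: Pbar_ge0.
Qed.

(** The pieces [F n] of a cover of [E] are arbitrary sets, hence the outer measure
    [out] generated by [theta].  On each piece, the balls supplied by the lower density
    carry all the mass, and Besicovitch's theorem bounds their sum by that of
    packings. *)
Lemma theta_le_Pmeas s E : (0 < s)%R -> measurable (E : set (Rd R d)) ->
  (forall x, E x -> ldensity x < s%:E) ->
  theta E <= (N%:R * s)%:E * Pmeas E.
Proof.
move=> s0 mE Es.
have Ns0 : (0 < N%:R * s)%R by rewrite mulr_gt0// ltr0n.
rewrite -lee_pdivrMl//; apply: le_ereal_inf_tmp => _ [F EF <-].
rewrite lee_pdivrMl//.
pose out := mu_ext theta.
have piece A : out (A `&` E) <= (N%:R * s)%:E * Pbar A.
  rewrite -lee_pdivrMl//; apply: le_ereal_inf_tmp => _ [c /= c0 <-].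
  rewrite lee_pdivrMl//.
  have /choice[r rP] : forall x, exists r, (A `&` E) x ->
      (0 < r <= c)%R /\ theta (eball x r) <= s%:E * gauge x r.
    move=> x; have [[Ax Ex]|] := pselect ((A `&` E) x); last by exists 0%R.
    have [r /andP[r0 rc] rs] := ldensity_lt (Es _ Ex) c0.
    by exists r => _; split; [rewrite r0 ltW|exact: ratio_lt].
  have [I [b [Ib Fb bes]]] :=
    @besicovitch R d (A `&` E) r c (fun x Ax => (rP x Ax).1).
  apply: (@le_trans _ _ (out (\bigcup_(i in I) eball (b i) (r (b i))))).
    exact: le_mu_ext.
  rewrite /out measurable_mu_extE; last first.
    by apply: bigcup_measurable => i _; exact: measurable_eball.
  apply: (@le_trans _ _ (s%:E * (\esum_(i in I) gauge (b i) (r (b i))))).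
    apply: covering_mass => // [i|i|i /Ib /rP[]//]; first exact: measurable_eball.
    exact: gauge_ge0.
  rewrite mulrC EFinM -muleA lee_wpmul2l ?lee_fin ?(ltW s0)//.
  apply: bes => [i|J JI tJ]; first exact: gauge_ge0.
  apply: ereal_sup_ubound; exists J, b, (r \o b); split => //; split => // i Ji.
  by have [Ab _] := Ib _ (JI _ Ji); split => //; case: (rP _ (Ib _ (JI _ Ji))).
apply: (@le_trans _ _ (\sum_(n <oo) out (F n `&` E))); last first.
  rewrite -nneseriesZl; last by move=> *; exact: Pbar_ge0.
  by apply: lee_nneseries => // n _ _; exact: mu_ext_ge0.
rewrite -(measurable_mu_extE theta mE).
apply: (@le_trans _ _ (out (\bigcup_n (F n `&` E)))).
  by apply: le_mu_ext => x Ex; have [n _ Fx] := EF _ Ex; exists n.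
exact: mu_ext_sigma_subadditive.
Qed.

(** Packings whose centres lie in a shell of [U] stay in a slightly larger shell, and
    these larger shells overlap at most three times, so summing over the shells
    costs only a factor 3. *)
Lemma Pmeas_le_uniform s c E : (0 < s)%R -> (0 < c)%R ->
  measurable (E : set (Rd R d)) ->
  (forall x r, E x -> (0 < r < c)%R ->
     s%:E * gauge x r <= theta (eball x r)) ->
  s%:E * Pmeas E <= 3%:E * theta E.
Proof.
move=> s0 c0 mE Es; apply: lee_pmul2l_addgt0 => // e e0.
have [U [oU EU Ue]] := outer_regular theta mE e0.
pose h j : R := (2 ^- j)%R.
have h0 j : (0 < h j)%R by rewrite invr_gt0 exprn_gt0.
have hS j : (h j = 2 * h j.+1)%R.
  by rewrite /h exprS invfM mulrA divff// mul1r.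
have hle i j : (i <= j)%N -> (h j <= h i)%R.
  by move=> ij; rewrite lef_pV2 ?posrE ?exprn_gt0// ler_eXn2l// ltr1n.
(* [G j]: points at distance at least [2^-j] from the complement of [U], except that
   [G 0] is empty, so that the shell [W 0] is empty and indices can be lowered. *)
pose G j := [set y : 'rV[R]_d | (0 < j)%N /\
               forall z, (edist y z < h j)%R -> U z].
have GU j : G j `<=` U by move=> y [_]; apply; rewrite edistxx.
have mG j : measurable (G j : set (Rd R d)).
  have [j0|j0] := posnP j.
    by rewrite (_ : G j = set0)//; apply/seteqP; split=> // y [/[!j0]].
  rewrite -[G j]setCK; apply: measurableC; apply: open_measurable_Rd.
  apply/open_edistP => y /not_andP[//|/existsNP[z /not_implyP[yz nUz]]].
  exists (h j - edist y z)%R => [|w yw]; first by rewrite subr_gt0.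
  move=> [_ /(_ z) Uz]; apply: nUz; apply: Uz.
  by have := edist_triangle y w z; rewrite (edistC w y); lra.
have ndG : nondecreasing_seq G.
  apply/nondecreasing_seqP => j; apply/subsetPset => y [j0 Uy]; split => // z yz.
  by apply: Uy; apply: lt_le_trans (hle _ _ (leqnSn j)).
pose W := seqD G.
have mW j : measurable (W j : set (Rd R d)).
  by case: j => [|j]; rewrite /W/=; [exact: mG|exact: measurableD].
have WU j : W j `<=` U by case: j => [|j] y; [exact: GU|case=> /GU].
have mU := open_measurable_Rd oU.
pose L j := E `&` W j.+1.
have EL : E `<=` \bigcup_j L j.
  move=> x Ex; have [a a0 Ua] := (open_edistP U).1 oU x (EU _ Ex).
  have [n na] : exists n, (h n < a)%R.
    have [n na] := exists_invS_lt a0; exists n; apply: le_lt_trans na.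
    by rewrite lef_pV2 ?posrE ?exprn_gt0// -natrX ler_nat ltn_expl.
  have : (\bigcup_j W j) x.
    rewrite eq_bigcup_seqD; exists n.+1 => //; split => // z xz; apply: Ua.
    by apply: lt_trans na; apply: lt_le_trans xz _; exact: hle.
  case=> -[|j] _ Wx; first by case: Wx.
  by exists j.
have piece j : s%:E * Pbar (L j) <= theta (W j) + theta (W j.+1) + theta (W j.+2).
  pose dl := Num.min (c / 2)%R (h j.+2).
  have dl0 : (0 < dl)%R by rewrite lt_min divr_gt0// h0.
  apply: (@le_trans _ _ (s%:E * Pdelta dl (L j))).
    by rewrite lee_wpmul2l ?lee_fin ?(ltW s0)//; apply: ereal_inf_lbound; exists dl.
  rewrite muleC -lee_pdivlMr// muleC.
  apply: ge_ereal_sup => _ [I [x [r [[xr tr] ->]]]].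
  rewrite lee_pdivlMl//.
  apply: (@le_trans _ _ (theta (W j `|` W j.+1 `|` W j.+2))); last first.
    apply: le_trans (measureU2 _ _ _) _ => //; first exact: measurableU.
    by rewrite leeD2r//; exact: measureU2.
  apply: packing_mass tr _ _ _ _ => //.
  - by move=> i; exact: measurable_eball.
  - by do 2 apply: measurableU => //.
  - move=> i Ii y /=; rewrite /eball/= => xy.
    have [[Ex Wx] /andP[r0]] := xr i Ii; rewrite le_min => /andP[_ rh].
    case: Wx => -[_ Gx] nGx.
    have h2 := hS j; have h3 := hS j.+1.
    (* The radius is at most [2^-(j+2)]: moving from [x i] to [y] changes the index of
       the shell by at most one. *)
    have Gy : G j.+2 y.
      split => // z yz; apply: Gx; have := edist_triangle y (x i) z; lra.
    have [Gj|nGj] := pselect (G j y); last first.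
      have [Gj1|nGj1] := pselect (G j.+1 y); first by left; right.
      by right.
    have [j0|j0] := posnP j; first by case: Gj => + _; rewrite {1}j0 ltnn.
    have WE : W j = G j `\` G j.-1 by case: (j) j0.
    left; left; rewrite WE; split => // -[j10 Uy]; apply: nGx; split => // z xz.
    have h4 := hS j.-1; rewrite prednK// in h4; apply: Uy.
    by have := edist_triangle (x i) y z; rewrite (edistC y (x i)); have := h0 j.+2; lra.
  - by move=> i; exact: gauge_ge0.
  - move=> i Ii; have [[Ex _] /andP[r0]] := xr i Ii; rewrite le_min => /andP[rc _].
    apply: Es => //; rewrite r0; apply: le_lt_trans rc _.
    by rewrite ltr_pdivrMr// ltr_pMr// ltr1n.
apply: (@le_trans _ _ (s%:E * \sum_(j <oo) Pbar (L j))).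
  rewrite lee_wpmul2l ?lee_fin ?(ltW s0)//; apply: ereal_inf_lbound.
  by exists L.
rewrite -nneseriesZl; last by move=> *; exact: Pbar_ge0.
apply: (@le_trans _ _ (\sum_(j <oo) (theta (W j) + theta (W j.+1) + theta (W j.+2)))).
  apply: lee_nneseries => [j _ _|j _]; last exact: piece.
  by rewrite mule_ge0 ?Pbar_ge0// lee_fin ltW.
rewrite !nneseriesD//; last by move=> *; rewrite adde_ge0.
have shift i : \sum_(j <oo) theta (W (j + i)%N) <= theta E + e%:E.
  apply: le_trans Ue; apply: disjoint_mass => //.
  apply/trivIsetP => a b _ _ ab; have /trivIsetP := trivIset_seqD ndG.
  by apply => //; rewrite eqn_add2r.
have -> : 3%:E = (1 + 1 + 1)%:E :> \bar R by congr EFin; ring.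
rewrite !EFinD !ge0_muleDl ?lee_fin// !mul1e.
have := shift 0%N; have := shift 1%N; have := shift 2%N.
under eq_eseriesr do rewrite addn2.
under [X in _ -> X <= _ -> _]eq_eseriesr do rewrite addn1.
under [X in _ -> _ -> X <= _ -> _]eq_eseriesr do rewrite addn0.
by move=> H2 H1 H0; rewrite leeD// leeD.
Qed.


Lemma Smu_ball_mass_gt0 x r i : Smu mu x -> (0 < r)%R ->
  (0 < ball_mass (mu i) x r)%R.
Proof.
move=> /(_ i I) sx r0; rewrite -lte_fin -ball_massE.
apply: (@lt_le_trans _ _ (mu i [set y | (edist x y < r)%R])).
  by apply: sx; [exact: open_oball|rewrite /= edistxx].
apply: le_measure; rewrite ?inE; last by move=> y /ltW.
  by apply: open_measurable_Rd; exact: open_oball.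
exact: measurable_eball.
Qed.

(** Only rational radii, which makes the set Borel; by [gauge_side_le_rat] they
    decide about all radii. *)
Definition gauge_dominated s (c : R) : set 'rV[R]_d :=
  [set x | forall p : rat, (0 < (ratr p : R) < c)%R ->
     (gauge_side mu nu q t s x (ratr p) <= mass_side mu nu q t theta x (ratr p))%R].

Lemma measurable_gauge_dominated s c : measurable (gauge_dominated s c : set (Rd R d)).
Proof.
pose bad (p : rat) : set (Rd R d) := if (0 < (ratr p : R) < c)%R then
  [set x | (mass_side mu nu q t theta x (ratr p) < gauge_side mu nu q t s x (ratr p))%R]
  else set0.
have -> : gauge_dominated s c = ~` \bigcup_p bad p.
  apply/seteqP; split=> x.
    move=> gx [p _]; rewrite /bad; case: ifP => // /gx /=.
    by rewrite leNgt => /negP.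
  move=> nb p pc; rewrite leNgt; apply/negP => bp; apply: nb; exists p => //.
  by rewrite /bad pc.
apply: measurableC; apply: bigcupT_measurable_rat => p; rewrite /bad.
case: ifP => // _.
have := measurable_fun_ltr (@measurable_mass_side R d k mu nu q t theta (ratr p))
  (@measurable_gauge_side R d k mu nu q t s (ratr p)) measurableT (_ : measurable [set true]).
move=> /(_ _)/wrap[//|]; rewrite setTI; exact.
Qed.

(** On the support of [mu] all factors coming from [mu] are positive, which is what
    allows the exponents to be moved across the inequality. *)
Lemma gauge_dominatedP s c x : (0 < s)%R -> Smu mu x ->
  gauge_dominated s c x <->
  forall r, (0 < r < c)%R -> s%:E * gauge x r <= theta (eball x r).
Proof.
move=> s0 Sx.
have glm r : (0 < r)%R -> (s%:E * gauge x r <= theta (eball x r)) =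
    (gauge_side mu nu q t s x r <= mass_side mu nu q t theta x r)%R.
  by move=> r0; apply: gauge_le_mass => // i; exact: Smu_ball_mass_gt0.
split=> [gx r /andP[r0 rc]|H p /andP[p0 pc]]; last by rewrite -glm// H// p0.
rewrite glm//; apply: (gauge_side_le_rat (ltW s0) rc) => p /andP[rp pc].
by apply: gx; rewrite pc (lt_trans r0).
Qed.

(** The sets where the comparison holds up to radius [1/(n+1)] increase to [E]; on
    their successive differences it is uniform. *)
Lemma Pmeas_le s E : (0 < s)%R -> measurable (E : set (Rd R d)) ->
  E `<=` Smu mu -> (forall x, E x -> s%:E < ldensity x) ->
  s%:E * Pmeas E <= 3%:E * theta E.
Proof.
move=> s0 mE ES Es.
pose D n := E `&` gauge_dominated s n.+1%:R^-1%R.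
have mD n : measurable (D n : set (Rd R d)).
  by apply: measurableI => //; exact: measurable_gauge_dominated.
have ndD : nondecreasing_seq D.
  apply/nondecreasing_seqP => n; apply/subsetPset; apply: setIS => x gx p.
  move=> /andP[p0 pn]; apply: gx; rewrite p0 (lt_le_trans pn)//.
  by rewrite lef_pV2 ?posrE// ler_nat.
have ED : E = \bigcup_n D n.
  apply/seteqP; split=> [x Ex|x [n _ []//]].
  have [c c0 cP] := ldensity_gt (Es _ Ex).
  have [n nc] := exists_invS_lt c0; exists n => //; split => //.
  apply/gauge_dominatedP => // [|r /andP[r0 rn]]; first exact: ES.
  by apply: ratio_gt => //; apply: cP; rewrite r0 (lt_trans rn).
pose A := seqD D.
have mA n : measurable (A n : set (Rd R d)).
  by case: n => [|n]; [exact: mD|exact: measurableD].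
have AD n : A n `<=` D n by case: n => [|n] x // [].
have EA : E = \bigcup_n A n by rewrite eq_bigcup_seqD.
apply: (@le_trans _ _ (s%:E * \sum_(n <oo) Pmeas (A n))).
  rewrite lee_wpmul2l ?lee_fin ?(ltW s0)//.
  by apply: Pmeas_sigma_subadditive; rewrite -EA.
rewrite -nneseriesZl; last by move=> *; exact: Pmeas_ge0.
apply: (@le_trans _ _ (\sum_(n <oo) 3%:E * theta (A n))).
  apply: lee_nneseries => [n _ _|n _].
    by rewrite mule_ge0 ?Pmeas_ge0// lee_fin ltW.
  apply: (@Pmeas_le_uniform s n.+1%:R^-1%R) => // x r /AD[Ex gx].
  by have /(gauge_dominatedP _ s0 (ES _ Ex)) := gx; apply.
rewrite nneseriesZl// lee_wpmul2l ?lee_fin//.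
apply: disjoint_mass => //; first exact: trivIset_seqD.
by move=> n x /AD[].
Qed.

Lemma udensity_ge0 x : 0 <= udensity x.
Proof. by apply: limf_esup_ge0 => [|r]; [exact: filter_not_empty|exact: ratio_ge0]. Qed.

Lemma ldensity_ge0 x : 0 <= ldensity x.
Proof.
rewrite /ldensity limf_einfE.
apply: (@le_trans _ _ (ereal_inf (ratio x @` setT))).
  by apply: le_ereal_inf_tmp => _ [r _ <-]; exact: ratio_ge0.
by apply: ereal_sup_ubound; exists setT => //; exact: filterT.
Qed.

End Densities.

Section Limits.
Context (R : realType).
Implicit Types (h v : \bar R) (a C : R).

(** The passage from [s] to the infimum [v] of the densities.  When [v] is infinite,
    [h] must vanish because [a] is finite. *)
Lemma density_lower_bound C h v a : (0 < C)%R -> 0 <= h -> (0 <= a)%R ->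
  (forall s : R, (0 < s)%R -> s%:E < v -> s%:E * h <= C%:E * a%:E) ->
  C^-1%:E * h * v <= a%:E.
Proof.
move=> C0 h0 a0 H.
have Ch0 : 0 <= C^-1%:E * h by rewrite mule_ge0// lee_fin invr_ge0 ltW.
have [v0|v0] := leP v 0.
  by apply: (@le_trans _ _ 0); [exact: mule_ge0_le0|rewrite lee_fin].
have hfin : h \is a fin_num.
  rewrite ge0_fin_numE// ltey; apply/eqP => hoo.
  have [s s0 sv] : exists2 s : R, (0 < s)%R & s%:E < v.
    move: v0 {H Ch0}; case: v => [v|_|]//; last by exists 1%R => //; exact: ltry.
    rewrite lte_fin => v0; exists (v / 2)%R; first by rewrite divr_gt0.
    by rewrite lte_fin ltr_pdivrMr// ltr_pMr// ltr1n.
  by have := H s s0 sv; rewrite hoo gt0_muley ?lte_fin// -EFinM leye_eq.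
move: hfin h0 H {Ch0} => /fineK <-; set b := fine h; rewrite lee_fin => b0.
move: b0; rewrite le_eqVlt => /predU1P[<- _|b0 H].
  by rewrite mule0 mul0e lee_fin.
rewrite -EFinM.
have {}H s : (0 < s)%R -> s%:E < v -> (s * b <= C * a)%R.
  by move=> s0 sv; rewrite -lee_fin !EFinM H.
move: v v0 H => [v||]// v0 H; last first.
  have Ca : (0 <= C * a)%R by rewrite mulr_ge0// ltW.
  have Cab : (0 < (C * a + 1) / b)%R by rewrite divr_gt0// ltr_wpDl.
  by have := H _ Cab (ltry _); rewrite divfK ?gt_eqF// gerDl ler10.
rewrite lte_fin in v0; rewrite -EFinM lee_fin leNgt; apply/negP.
rewrite -mulrA ltr_pdivlMl// => lt.
have Cb0 : (0 <= C * a / b)%R by rewrite divr_ge0 ?mulr_ge0 ?(ltW C0) ?(ltW b0).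
have Cbv : (C * a / b < v)%R by rewrite ltr_pdivrMr// (mulrC v).
have s0 : (0 < (C * a / b + v) / 2)%R by rewrite divr_gt0// ltr_wpDl.
have sv : ((C * a / b + v) / 2 < v)%R by rewrite ltr_pdivrMr//; lra.
have := H _ s0 sv.
rewrite mulrAC mulrDl divfK ?gt_eqF// ler_pdivrMr// (mulrC v); lra.
Qed.

(** The passage from [s] to the supremum [v] of the densities.  A negative [v] can
    only be the supremum [-oo] over the empty set. *)
Lemma density_upper_bound C h v a : (0 < C)%R -> 0 <= h -> h < +oo ->
  (v < 0 -> h = 0) ->
  (forall s : R, (0 < s)%R -> v < s%:E -> a%:E <= (C * s)%:E * h) ->
  ~ (h = 0 /\ v = +oo) -> a%:E <= C%:E * h * v.
Proof.
move=> C0 h0 hoo vh H nhv.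
have [v0|v0] := ltP v 0.
  have := H 1%R ltr01 (lt_trans v0 (lte01)); rewrite (vh v0) mule0.
  by rewrite mule0 mul0e.
have /fineK hE : h \is a fin_num by rewrite ge0_fin_numE.
move: hE h0 nhv H {vh hoo} => <-; set b := fine h; rewrite lee_fin => b0 nhv H.
case: v v0 nhv H => [v||]// v0 nhv H; last first.
  rewrite -EFinM gt0_muley ?leey// lte_fin mulr_gt0// lt_def b0 andbT.
  by apply/eqP => bE; apply: nhv; rewrite bE.
rewrite lee_fin in v0; apply/lee_addgt0Pr => e e0.
have Cb : (0 < C * b + 1)%R by rewrite ltr_wpDl// mulr_ge0// ltW.
have ee0 : (0 < e / (C * b + 1))%R by rewrite divr_gt0.
have := H (v + e / (C * b + 1))%R; rewrite lte_fin ltrDl.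
move=> /(_ (ltr_wpDl v0 ee0) ee0) /le_trans; apply.
rewrite -!EFinM -EFinD lee_fin mulrAC mulrDr lerD2l mulrCA ger_pMr//.
by rewrite ler_pdivrMr// mul1r lerDl.
Qed.

End Limits.

Theorem theorem4p1 (R : realType) (d k : nat) (d_gt0 : (0 < d)%N)
    (k_gt0 : (0 < k)%N) (mu : 'I_k -> probability (Rd R d) R)
    (nu : probability (Rd R d) R) (alpha : R) (alpha_gt0 : (0 < alpha)%R)
    (nu_qA : quasi_ahlfors nu alpha) (theta : probability (Rd R d) R)
    (q : 'I_k -> R) (t : R) :
  exists C1 C2 : R, [/\ (0 < C1)%R, (0 < C2)%R &
    forall E : set (Rd R d), measurable E -> E `<=` Smu mu ->
      let H := Hmeas mu nu q t E in
      let P := Pmeas mu nu q t E in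
      let ud := [set udensity mu nu q t theta x | x in E] in
      let ld := [set ldensity mu nu q t theta x | x in E] in
      (H < +oo ->
         C1%:E * H * ereal_inf ud <= theta E /\
         (~ (H = 0 /\ ereal_sup ud = +oo) ->
            theta E <= C2%:E * H * ereal_sup ud)) /\
      (P < +oo ->
         C1%:E * P * ereal_inf ld <= theta E /\
         (~ (P = 0 /\ ereal_sup ld = +oo) ->
            theta E <= C2%:E * P * ereal_sup ld))].
Proof.
set N : R := (besicovitch_bound d).+1%:R.
have N1 : (1 <= N)%R by rewrite ler1n.
have N0 : (0 < N)%R by rewrite ltr0n.
have N30 : (0 < N + 3)%R by rewrite addr_gt0.
exists (N + 3)^-1%R, N; split; [by rewrite invr_gt0|by []|].
move=> E mE ES; cbv zeta.
have thE := probability_fin theta mE; set a := fine (theta E) in thE.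
have a0 : (0 <= a)%R by exact: fine_ge0.
have inf_lt (f : 'rV[R]_d -> \bar R) (s : R) x : E x ->
    s%:E < ereal_inf [set f x | x in E] -> s%:E < f x.
  by move=> Ex /lt_le_trans; apply; apply: ereal_inf_lbound; exists x.
have sup_lt (f : 'rV[R]_d -> \bar R) (s : R) x : E x ->
    ereal_sup [set f x | x in E] < s%:E -> f x < s%:E.
  by move=> Ex; apply: le_lt_trans; apply: ereal_sup_ubound; exists x.
have sup_lt0 (f : 'rV[R]_d -> \bar R) : (forall x, 0 <= f x) ->
    ereal_sup [set f x | x in E] < 0 -> forall x, ~ E x.
  move=> f0 sf x Ex; move: sf; apply/negP; rewrite -leNgt.
  by apply: le_trans (f0 x) _; apply: ereal_sup_ubound; exists x.
have E0 : (forall x, ~ E x) -> theta E = 0.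
  by move=> nE; rewrite (_ : E = set0) ?measure0//; apply/seteqP; split.
rewrite thE; split=> fin; split.
- apply: density_lower_bound => //; first exact: Hmeas_ge0.
  move=> s s0 sE; rewrite -thE.
  apply: (@le_trans _ _ (N%:E * theta E)); last first.
    by rewrite lee_wpmul2r// lee_fin lerDl.
  by apply: Hmeas_le => // x Ex; exact: inf_lt sE.
- apply: density_upper_bound => //; first exact: Hmeas_ge0.
    move=> /(sup_lt0 _ (udensity_ge0 mu nu q t theta)) nE.
    apply/eqP; rewrite eq_le Hmeas_ge0 andbT -[leLHS]mul1e.
    apply: le_trans (@Hmeas_le _ _ _ mu nu q t theta _ _ ltr01 mE _) _; first by move=> x /nE.
    by rewrite E0// mule0.
  move=> s s0 sE; rewrite -thE.
  apply: (@le_trans _ _ (s%:E * Hmeas mu nu q t E)).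
    by apply: theta_le_Hmeas => // x Ex; exact: sup_lt sE.
  by rewrite lee_wpmul2r ?Hmeas_ge0// lee_fin ler_peMl// ltW.
- apply: density_lower_bound => //; first exact: Pmeas_ge0.
  move=> s s0 sE; rewrite -thE.
  apply: (@le_trans _ _ (3%:E * theta E)); last first.
    by rewrite lee_wpmul2r// lee_fin lerDr ltW.
  by apply: Pmeas_le => // x Ex; exact: inf_lt sE.
- apply: density_upper_bound => //; first exact: Pmeas_ge0.
    move=> /(sup_lt0 _ (ldensity_ge0 mu nu q t theta)) nE.
    apply/eqP; rewrite eq_le Pmeas_ge0 andbT -[leLHS]mul1e.
    apply: le_trans (@Pmeas_le _ _ _ mu nu q t theta _ _ ltr01 mE ES _) _; first by move=> x /nE.
    by rewrite E0// mule0.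
  move=> s s0 sE; rewrite -thE.
  by apply: theta_le_Pmeas => // x Ex; exact: sup_lt sE.
Qed.
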